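(* Let $\mathbb{K}$ be a field and let $G$ be a chordal graph with vertex set $\{1,\ldots,n\}$. Let $S=\mathbb{K}[x_1,\ldots,x_n,y_1,\ldots,y_n]$ and let $J_G\subseteq S$ be the binomial edge ideal of $G$. Then $\operatorname{reg}(S/J_G)\leq c(G)$, where $c(G)$ is the number of maximal cliques of $G$.
   Context: All graphs are finite and simple (no loops, no directed and no multiple edges). A graph is chordal if it has no induced cycle of length greater than $3$. For a graph $G$ with vertex set $V(G)=\{1,\ldots,n\}$ and edge set $E(G)$, the binomial edge ideal $J_G$ is the ideal of the polynomial ring $S=\mathbb{K}[x_1,\ldots,x_n,y_1,\ldots,y_n]$ over a field $\mathbb{K}$ generated by all $f_{ij}=x_iy_j-x_jy_i$ with $\{i,j\}\in E(G)$ and $1\leq i<j\leq n$. $S$ carries the standard grading, and $\operatorname{reg}(S/J_G)=\max\{j-i:\beta_{i,j}(S/J_G)\neq 0\}$ is the Castelnuovo-Mumford regularity, where $\beta_{i,j}$ are the graded Betti numbers of $S/J_G$ over $S$. $c(G)$ is the number of maximal cliques of $G$, where a clique is a set of pairwise adjacent vertices (a complete subgraph) and maximality is with respect to inclusion (an isolated vertex is a maximal clique). *)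

(* Defs.v *)
From mathcomp Require Import all_boot all_order all_algebra.
From mathcomp Require Import mpoly.

Set Implicit Arguments.
Unset Strict Implicit.
Unset Printing Implicit Defensive.

Import GRing.Theory Num.Theory.

Local Open Scope ring_scope.

(* The vertices 1, ..., n are represented by 0, ..., n - 1 in 'I_n. *)

Section Graphs.

Variables (n : nat) (e : rel 'I_n).

(* mpoly also has a predicate named symmetric. *)
Definition simple_graph : Prop := ssrbool.symmetric e /\ irreflexive e.

(* The edges of the graph joining two vertices of c are exactly those between
   cyclically consecutive vertices of c. *)
Definition induced_cycle (c : seq 'I_n) : bool :=
  ucycleb e c &&
  [forall u in c, forall v in c, e u v ==> (v == next c u) || (v == prev c u)].

Definition chordal : Prop :=
  forall c : seq 'I_n, induced_cycle c -> (size c <= 3)%N.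

Definition clique (A : {set 'I_n}) : bool :=
  [forall u in A, forall v in A, (u != v) ==> e u v].

Definition num_max_cliques : nat :=
  #|[set A : {set 'I_n} | maxset clique A]|.

End Graphs.

(* In {mpoly K[n + n]} the first n variables are the x_i, the last n the y_i. *)

Definition edge_binomial (K : fieldType) (n : nat) (i j : 'I_n) :
    {mpoly K[n + n]} :=
  'X_(lshift n i) * 'X_(rshift n j) - 'X_(lshift n j) * 'X_(rshift n i).

Definition binomial_edge_ideal (K : fieldType) (n : nat) (e : rel 'I_n)
    (p : {mpoly K[n + n]}) : Prop :=
  exists a : 'I_n -> 'I_n -> {mpoly K[n + n]},
    p = \sum_(i < n) \sum_(j < n | (i < j)%N && e i j)
          a i j * edge_binomial K i j.

(* A minimal graded free resolution of S/J, for S = K[X_1, ..., X_m]: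

     ... -> F_2 -> F_1 -> F_0 -> S/J -> 0.

   F_i is the space of row vectors of length mgr_rank i, its k-th basis vector
   having degree mgr_deg i k, i.e. F_i is the sum over k of S(- mgr_deg i k).
   The map F_(i+1) -> F_i is v |-> v *m mgr_diff i, and F_0 -> S/J is v |-> the
   class of v *m mgr_aug.  Degrees in nat are enough: S/J has no component of
   negative degree, hence neither has any F_i in a minimal resolution.
   Minimality says that the image of F_(i+1) lies in (X_1, ..., X_m) F_i. *)
Record min_graded_resolution (K : fieldType) (m : nat)
    (J : {mpoly K[m]} -> Prop) := MinGradedResolution {
  mgr_rank : nat -> nat;
  mgr_deg : forall i : nat, 'I_(mgr_rank i) -> nat;
  mgr_aug : 'cV[{mpoly K[m]}]_(mgr_rank 0);
  mgr_diff : forall i : nat,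
    'M[{mpoly K[m]}]_(mgr_rank i.+1, mgr_rank i);
  mgr_aug_homog : forall (k : 'I_(mgr_rank 0)) (u : 'X_{1..m}),
    u \in msupp (mgr_aug k 0) -> mdeg u = mgr_deg k;
  mgr_diff_homog : forall (i : nat) (k : 'I_(mgr_rank i.+1))
      (l : 'I_(mgr_rank i)) (u : 'X_{1..m}),
    u \in msupp (mgr_diff i k l) -> (mdeg u + mgr_deg l)%N = mgr_deg k;
  mgr_aug_surj : forall p : {mpoly K[m]},
    exists v : 'rV_(mgr_rank 0), J (p - (v *m mgr_aug) 0 0);
  mgr_aug_exact : forall v : 'rV_(mgr_rank 0),
    J ((v *m mgr_aug) 0 0) <-> exists w, v = w *m mgr_diff 0;
  mgr_diff_exact : forall (i : nat) (v : 'rV_(mgr_rank i.+1)),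
    v *m mgr_diff i = 0 <-> exists w, v = w *m mgr_diff i.+1;
  mgr_minimal : forall (i : nat) (k : 'I_(mgr_rank i.+1))
      (l : 'I_(mgr_rank i)),
    (mgr_diff i k l)@_0%MM = 0
}.

Arguments mgr_deg {K m J} _ i _.

Definition graded_betti (K : fieldType) (m : nat) (J : {mpoly K[m]} -> Prop)
    (F : min_graded_resolution J) (i j : nat) : nat :=
  #|[set k : 'I_(mgr_rank F i) | mgr_deg F i k == j]|.

(* reg(S/J) = r.  The graded Betti numbers do not depend on F, since a minimal
   graded free resolution is unique up to isomorphism. *)
Definition is_regularity (K : fieldType) (m : nat) (J : {mpoly K[m]} -> Prop)
    (r : int) : Prop :=
  exists F : min_graded_resolution J,
    (exists i j : nat, graded_betti F i j <> 0%N /\ j%:Z - i%:Z = r) /\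
    (forall i j : nat, graded_betti F i j <> 0%N -> j%:Z - i%:Z <= r).

(* Main.v *)
(* The bound is proved through truncated free resolutions, in the form of three
   rules for a short exact sequence 0 -> M' -> M -> M'' -> 0 of graded modules:
   reg M <= max (reg M') (reg M''), reg M'' <= max (reg M) (reg M' - 1) and
   reg M' <= max (reg M) (reg M'' + 1).

   If v has two non-adjacent neighbours and G_v is obtained from G by making
   the neighbourhood of v a clique, then J_G is the intersection of J_(G_v) and
   (x_v, y_v) + J_(G - v), whose sum is (x_v, y_v) + J_(G_v - v).  In a chordal
   graph, G_v is again chordal and has fewer maximal cliques than G, so
   induction applies to G_v, G - v and G_v - v.

   If no such v exists, then G is a disjoint union of cliques.  Let v be a
   vertex, C its set of neighbours and J' = J_(G - v).  Then J_G / J' is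
   isomorphic, with a shift of degrees by one, to (J' + (x_i, i in C)) / J', the
   generator f_iv corresponding to x_i, and the vertices of C no longer
   contribute edges to J' + (x_i, i in C). *)

Require Import Defs.
From Stdlib Require Import Classical ClassicalEpsilon.
From mathcomp Require Import all_boot all_order all_algebra.
From mathcomp Require Import mpoly.
From mathcomp Require Import ring.

Set Implicit Arguments.
Unset Strict Implicit.
Unset Printing Implicit Defensive.

Import Order.TTheory GRing.Theory Num.Theory.

Local Open Scope ring_scope.

(** * Graded matrices and graded submodules *)

(** Regularity is handled without Tor: a bound r is witnessed by any free resolution, minimal or
    not, whose i-th term is generated in degrees at most r + i. By [reg_upto_kernel], every cover
    generated in degrees at most r can then serve as its first step, so minimal covers can be chosen
    one after another. Truncation turns each rule into an induction on the number of steps. Modules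
    are subquotients P / Z of free modules, given by predicates.

    The ring never changes: a vertex is deleted by removing it from [A] and, in the intersection
    formula, by putting x_v and y_v into the ideal. That formula rests on x_v f_ij = x_i f_vj - x_j
    f_vi and its analogue for y_v.

    The sum of the two intersected ideals enters one homological step late, so its regularity counts
    plus one; the strict drop of the number of maximal cliques of G_v pays for it. For disjoint
    cliques, the quotient by J' + (x_i, i in C) also counts plus one, paid for by the clique
    containing v, which no longer contributes. *)

Section GradedMatrices.

Variables (K : fieldType) (m : nat).
Local Notation S := {mpoly K[m]}.

(** The condition deg p = a - b is written additively to avoid truncated subtraction; for a < b only
    p = 0 satisfies it. It describes an entry of a degree-preserving map S(-a) -> S(-b). *)
Definition ehomog (a b : nat) (p : S) : Prop :=
  forall u, u \in msupp p -> (mdeg u + b)%N = a.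

Lemma ehomog0 a b : ehomog a b 0.
Proof. by move=> u; rewrite msupp0. Qed.

Lemma ehomogD a b p q : ehomog a b p -> ehomog a b q -> ehomog a b (p + q).
Proof.
move=> hp hq u /msuppD_le; rewrite mem_cat => /orP[]; [exact: hp|exact: hq].
Qed.

Lemma ehomog_sum a b (I : Type) (s : seq I) (P : pred I) (F : I -> S) :
  (forall i, P i -> ehomog a b (F i)) -> ehomog a b (\sum_(i <- s | P i) F i).
Proof.
by move=> h; elim/big_ind: _ => //; [exact: ehomog0|exact: ehomogD].
Qed.

Lemma ehomogM a b c p q : ehomog a b p -> ehomog b c q -> ehomog a c (p * q).
Proof.
move=> hp hq u /msuppM_le /allpairsP[[u1 u2] /= [h1 h2 ->]].
by rewrite mdegD -addnA (hq _ h2) (hp _ h1).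
Qed.

Lemma ehomogN a b p : ehomog a b p -> ehomog a b (- p).
Proof. by move=> hp u; rewrite (perm_mem (msuppN _)); exact: hp. Qed.

Lemma ehomog1 a : ehomog a a 1.
Proof. by move=> u; rewrite msupp1 inE => /eqP->; rewrite mdeg0. Qed.

Lemma ehomogX a i : ehomog a.+1 a ('X_i).
Proof. by move=> u; rewrite msuppX inE => /eqP->; rewrite mdeg1. Qed.

Definition hmx q p (a : 'I_q -> nat) (d : 'I_p -> nat) (M : 'M[S]_(q, p)) :=
  forall k l, ehomog (a k) (d l) (M k l).

Lemma hmx0 q p a d : @hmx q p a d 0.
Proof. by move=> k l; rewrite mxE; exact: ehomog0. Qed.

Lemma hmxN q p a d (M : 'M_(q, p)) : hmx a d M -> hmx a d (- M).
Proof. by move=> hM k l; rewrite mxE; exact: ehomogN. Qed.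

Lemma hmxM r q p a b c (M : 'M_(r, q)) (N : 'M_(q, p)) :
  hmx a b M -> hmx b c N -> hmx a c (M *m N).
Proof.
by move=> hM hN k l; rewrite mxE; apply: ehomog_sum => i _; apply: ehomogM.
Qed.

Lemma hmx1 q a : @hmx q q a a 1%:M.
Proof.
move=> k l; rewrite mxE; case: eqP => [->|_]; [exact: ehomog1|exact: ehomog0].
Qed.

Lemma hmx_row q p a d (M : 'M_(q, p)) k :
  hmx a d M -> hmx (fun=> a k) d (row k M).
Proof. by move=> hM i l; rewrite mxE. Qed.

Lemma hmx_rowP q p a d (M : 'M_(q, p)) :
  (forall k, hmx (fun=> a k) d (row k M)) -> hmx a d M.
Proof. by move=> hM k l; have := hM k 0 l; rewrite mxE. Qed.

Definition dcat p q (d : 'I_p -> nat) (a : 'I_q -> nat) (i : 'I_(p + q)) :=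
  match split i with inl k => d k | inr k => a k end.

Lemma dcatl p q (d : 'I_p -> nat) (a : 'I_q -> nat) i :
  dcat d a (lshift q i) = d i.
Proof. by rewrite /dcat (unsplitK (inl i)). Qed.

Lemma dcatr p q (d : 'I_p -> nat) (a : 'I_q -> nat) i :
  dcat d a (rshift p i) = a i.
Proof. by rewrite /dcat (unsplitK (inr i)). Qed.

Lemma hmx_row_mx r p q a b c (M : 'M_(r, p)) (N : 'M_(r, q)) :
  hmx a b M -> hmx a c N -> hmx a (dcat b c) (row_mx M N).
Proof.
move=> hM hN k l; case: (split_ordP l) => i ->.
  by rewrite row_mxEl dcatl.
by rewrite row_mxEr dcatr.
Qed.

Lemma hmx_col_mx r p q a b c (M : 'M_(p, r)) (N : 'M_(q, r)) :
  hmx b a M -> hmx c a N -> hmx (dcat b c) a (col_mx M N).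
Proof.
move=> hM hN k l; case: (split_ordP k) => i ->.
  by rewrite col_mxEu dcatl.
by rewrite col_mxEd dcatr.
Qed.

(** The test d l <= j is essential: for j < d l the truncated j - d l would be 0 and select the
    constant part of the entry. *)
Definition hcomp p (d : 'I_p -> nat) (j : nat) (v : 'rV[S]_p) : 'rV[S]_p :=
  \row_l if (d l <= j)%N then pihomog mdeg (j - d l) (v 0 l) else 0.

Lemma mcoeff_hcomp p d j (v : 'rV_p) l u :
  (hcomp d j v 0 l)@_u = if (mdeg u + d l == j)%N then (v 0 l)@_u else 0.
Proof.
rewrite mxE; case: (leqP (d l) j) => dj; last first.
  rewrite mcoeff0; case: eqP => // e.
  by move: dj; rewrite -e ltnNge leq_addl.
case: (eqVneq (mdeg u + d l)%N j) => [<-|ne]; last first.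
  apply: (dhomog_nemf_coeff (pihomogP mdeg _ _)).
  by apply: contraNneq ne => ->; rewrite subnK.
rewrite addnK pihomogE raddf_sum /= -big_filter.
have [hu|hu] := boolP (u \in msupp (v 0 l)); last first.
  rewrite (memN_msupp_eq0 hu) big1_seq // => w; rewrite mem_filter /=.
  case/andP=> _ hw; rewrite mcoeffZ mcoeffX.
  by case: eqP hu => [<-|_ _]; rewrite ?hw ?mulr0.
rewrite (bigD1_seq u) ?mem_filter ?eqxx ?filter_uniq //=.
rewrite mcoeffZ mcoeffX eqxx mulr1 big1 ?addr0 // => w wu.
by rewrite mcoeffZ mcoeffX (negbTE wu) mulr0.
Qed.

Lemma hcompD p d j (v w : 'rV_p) :
  hcomp d j (v + w) = hcomp d j v + hcomp d j w.
Proof.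
apply/rowP => l; apply/mpolyP => u; rewrite [in RHS]mxE mcoeffD !mcoeff_hcomp.
by rewrite mxE; case: ifP => _; rewrite ?addr0 ?mcoeffD.
Qed.

Lemma hcomp0 p d j : @hcomp p d j 0 = 0.
Proof. by apply: (addrI (hcomp d j 0)); rewrite -hcompD !addr0. Qed.

Lemma hcompN p d j (v : 'rV_p) : hcomp d j (- v) = - hcomp d j v.
Proof. by apply: (addrI (hcomp d j v)); rewrite -hcompD !subrr hcomp0. Qed.

Lemma hcomp_sum p d j (I : Type) (s : seq I) (F : I -> 'rV_p) :
  hcomp d j (\sum_(i <- s) F i) = \sum_(i <- s) hcomp d j (F i).
Proof. by apply: (big_morph _ (@hcompD _ _ _)); rewrite hcomp0. Qed.

Lemma hmx_hcomp p d j (v : 'rV_p) : hmx (fun=> j) d (hcomp d j v).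
Proof.
move=> k l u; rewrite ord1 mcoeff_msupp mcoeff_hcomp.
by case: ifP => [/eqP //|_]; rewrite eqxx.
Qed.

Lemma hcomp_hmx p d i j (v : 'rV_p) :
  hmx (fun=> i) d v -> hcomp d j v = if i == j then v else 0.
Proof.
move=> hv; apply/rowP => l; apply/mpolyP => u; rewrite mcoeff_hcomp.
have [hu|hu] := boolP (u \in msupp (v 0 l)).
  by rewrite (hv 0 l u hu); case: ifP => // _; rewrite mxE mcoeff0.
by case: (i == j); rewrite ?mxE ?mcoeff0 ?(memN_msupp_eq0 hu) if_same.
Qed.

Lemma hcomp_total p d (v : 'rV_p) :
  exists N, v = \sum_(j < N) hcomp d j v.
Proof.
pose N := (\max_l (msize (v 0%R l) + d l))%N; exists N.
apply/rowP => l; rewrite summxE; apply/mpolyP => u; rewrite raddf_sum /=.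
under eq_bigr do rewrite mcoeff_hcomp.
have [hu|hu] := boolP (u \in msupp (v 0 l)); last first.
  by rewrite (memN_msupp_eq0 hu) big1 // => j _; case: ifP.
have lt : (mdeg u + d l < N)%N.
  apply: leq_trans (leq_bigmax l); rewrite ltn_add2r.
  exact: msize_mdeg_lt.
rewrite (bigD1 (Ordinal lt)) //= eqxx big1 ?addr0 // => j; rewrite -val_eqE /=.
by rewrite eq_sym => /negbTE ->.
Qed.

(** Both sides are additive in w, and by [hcomp_total] w is a finite sum of homogeneous rows, for
    which each side is the image of the row or 0. *)
Lemma hcompM q p a d (M : 'M_(q, p)) j (w : 'rV_q) :
  hmx a d M -> hcomp d j (w *m M) = hcomp a j w *m M.
Proof.
move=> hM; have [N E] := hcomp_total a w.
have hw i : hcomp d j (hcomp a i w *m M) = hcomp a j (hcomp a i w) *m M.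
  rewrite (hcomp_hmx _ (hmxM (@hmx_hcomp _ a i w) hM)).
  rewrite (hcomp_hmx (v := hcomp a i w) j (@hmx_hcomp _ a i w)).
  by case: eqP => // _; rewrite mul0mx.
rewrite {1}E mulmx_suml hcomp_sum {2}E hcomp_sum mulmx_suml.
exact: eq_bigr.
Qed.

Record gsub p (d : 'I_p -> nat) (N : 'rV[S]_p -> Prop) : Prop := GSub {
  gsub0 : N 0;
  gsubD : forall u v, N u -> N v -> N (u + v);
  gsubZ : forall a u, N u -> N (a *: u);
  gsubH : forall j u, N u -> N (hcomp d j u) }.

Section Sub.
Variables (p : nat) (d : 'I_p -> nat) (N : 'rV[S]_p -> Prop) (gN : gsub d N).

Lemma gsubN u : N u -> N (- u).
Proof. by move=> hu; rewrite -scaleN1r; apply: (gsubZ gN). Qed.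

Lemma gsubB u v : N u -> N v -> N (u - v).
Proof. by move=> hu hv; apply: (gsubD gN) => //; exact: gsubN. Qed.

Lemma gsub_sum (I : Type) (s : seq I) (P : pred I) (F : I -> 'rV_p) :
  (forall i, P i -> N (F i)) -> N (\sum_(i <- s | P i) F i).
Proof.
by move=> h; elim/big_ind: _ => //; [exact: (gsub0 gN)|exact: (gsubD gN)].
Qed.

Lemma gsub_mulmx q (M : 'M_(q, p)) w : (forall i, N (row i M)) -> N (w *m M).
Proof.
by move=> h; rewrite mulmx_sum_row; apply: gsub_sum => i _; apply: (gsubZ gN).
Qed.

Lemma gsub_subl u v : N (u - v) -> N u -> N v.
Proof.
by move=> h hu; have := gsubB hu h; rewrite opprB addrC subrK.
Qed.

Lemma gsub_subr u v : N (u - v) -> N v -> N u.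
Proof. by move=> h hv; have := gsubD gN h hv; rewrite subrK. Qed.

Lemma gsub_preim q a (M : 'M_(q, p)) :
  hmx a d M -> gsub a (fun w => N (w *m M)).
Proof.
move=> hM; split => [|u v hu hv|c u hu|j u hu].
- by rewrite mul0mx; exact: (gsub0 gN).
- by rewrite mulmxDl; exact: (gsubD gN).
- by rewrite -scalemxAl; exact: (gsubZ gN).
- by rewrite -(hcompM _ _ hM); exact: (gsubH gN).
Qed.

End Sub.

Lemma gsub_eq p (d : 'I_p -> nat) M N :
  (forall v, M v <-> N v) -> gsub d M -> gsub d N.
Proof.
move=> e [m0 mD mZ mH]; split => [|u v|a u|j u]; rewrite -?e //.
- exact: mD.
- exact: mZ.
- exact: mH.
Qed.

Lemma gsub_zero p (d : 'I_p -> nat) : gsub d (fun v => v = 0).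
Proof.
split => // [u v -> ->|a u ->|j u ->]; rewrite ?addr0 ?scaler0 ?hcomp0 //.
Qed.

Lemma gsub_full p (d : 'I_p -> nat) : gsub d (fun=> True).
Proof. by []. Qed.

Lemma gsubI p (d : 'I_p -> nat) M N :
  gsub d M -> gsub d N -> gsub d (fun v => M v /\ N v).
Proof.
case=> [m0 mD mZ mH] [n0 nD nZ nH]; split => //.
- by move=> u v [? ?] [? ?]; split; [exact: mD|exact: nD].
- by move=> a u [? ?]; split; [exact: mZ|exact: nZ].
- by move=> j u [? ?]; split; [exact: mH|exact: nH].
Qed.

End GradedMatrices.

(** * Truncated resolutions *)

Section Regularity.

Variables (K : fieldType) (m : nat).
Local Notation S := {mpoly K[m]}.

Record graded_cover p (d : 'I_p -> nat) (P Z : 'rV[S]_p -> Prop) (r : nat)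
    q (a : 'I_q -> nat) (M : 'M[S]_(q, p)) : Prop := GradedCover {
  cover_hmx : hmx a d M;
  cover_deg : forall i, (a i <= r)%N;
  cover_row : forall i, P (row i M);
  cover_gen : forall x, P x -> exists w, Z (x - w *m M) }.

(* [reg_upto k d P Z r] says that the graded module P / Z has a free
   resolution whose i-th term is generated in degrees at most r + i, for all
   i < k. *)
Fixpoint reg_upto k p (d : 'I_p -> nat) (P Z : 'rV[S]_p -> Prop) (r : nat)
    : Prop :=
  if k is k'.+1 then
    exists q (a : 'I_q -> nat) (M : 'M[S]_(q, p)),
      graded_cover d P Z r a M /\
      reg_upto k' a (fun w => Z (w *m M)) (fun w => w = 0) r.+1
  else True.

Lemma reg_upto_mono k l r s p (d : 'I_p -> nat) P Z :
  (k <= l)%N -> (r <= s)%N -> reg_upto l d P Z r -> reg_upto k d P Z s.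
Proof.
elim: k l r s p d P Z => [//|k IH] [//|l] r s p d P Z kl rs.
move=> [q [a [M [[hM ar hP hg] hR]]]].
exists q, a, M; split; last exact: IH hR.
by split=> // i; apply: leq_trans rs.
Qed.

Lemma reg_upto_eq k r p (d : 'I_p -> nat) P Z P' Z' :
  (forall v, P v <-> P' v) -> (forall v, Z v <-> Z' v) ->
  reg_upto k d P Z r -> reg_upto k d P' Z' r.
Proof.
elim: k r p d P Z P' Z' => [//|k IH] r p d P Z P' Z' eP eZ.
move=> [q [a [M [[hM ar hP hg] hR]]]]; exists q, a, M; split.
  split=> // [i|x]; first exact/eP.
  by move=> /eP/hg[w hw]; exists w; apply/eZ.
by apply: IH hR => // v; apply: eZ.
Qed.

Lemma rows_exist p q (A : 'I_q -> 'rV[S]_p -> Prop) :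
  (forall i, exists x, A i x) -> exists X : 'M_(q, p), forall i, A i (row i X).
Proof.
move=> /fin_all_exists[f hf]; exists (\matrix_i f i) => i.
by rewrite rowK.
Qed.

(** X acts on representatives; well-definedness and injectivity of the induced map P / Z -> P' / Z'
    are the two directions of [giso_ker]. *)
Record giso p p' (d : 'I_p -> nat) (P Z : 'rV[S]_p -> Prop)
    (d' : 'I_p' -> nat) (P' Z' : 'rV[S]_p' -> Prop) (X : 'M[S]_(p, p'))
    : Prop := GIso {
  giso_hmx : hmx d d' X;
  giso_im : forall x, P x -> P' (x *m X);
  giso_ker : forall x, P x -> (Z x <-> Z' (x *m X));
  giso_surj : forall y, P' y -> exists2 x, P x & Z' (y - x *m X) }.

Section Iso.
Variables (p p' : nat) (d : 'I_p -> nat) (P Z : 'rV[S]_p -> Prop)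
    (d' : 'I_p' -> nat) (P' Z' : 'rV[S]_p' -> Prop) (X : 'M[S]_(p, p')).
Hypotheses (gP : gsub d P) (gZ : gsub d Z) (gP' : gsub d' P')
  (gZ' : gsub d' Z') (ZP : forall v, Z v -> P v) (iX : giso d P Z d' P' Z' X).

Lemma reg_upto_image k r : reg_upto k d P Z r -> reg_upto k d' P' Z' r.
Proof.
case: iX => hX im ker surj.
case: k => [//|k] [q [a [M [[hM ar hP hg] hR]]]].
exists q, a, (M *m X); split.
  split=> // [|i|y hy].
  - exact: hmxM hX.
  - by rewrite row_mul; apply: im.
  have [x hx yx] := surj _ hy; have [w hw] := hg _ hx; exists w.
  have := gsubD gZ' yx; rewrite mulmxA; move/(_ ((x - w *m M) *m X)).
  rewrite mulmxBl addrA subrK; apply; rewrite -mulmxBl; apply/ker => //.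
  exact: ZP.
apply: reg_upto_eq hR => // w; rewrite mulmxA; apply: ker.
exact: (gsub_mulmx gP).
Qed.

Lemma reg_upto_preimage k r : reg_upto k d' P' Z' r -> reg_upto k d P Z r.
Proof.
case: iX => hX im ker surj.
case: k => [//|k] [q [a [M' [[hM ar hP hg] hR]]]].
have [M hMP] : exists M : 'M_(q, p), forall i,
    [/\ P (row i M), hmx (fun=> a i) d (row i M) &
        Z' (row i M' - row i M *m X)].
  apply: (rows_exist (A := fun i x => [/\ P x, hmx (fun=> a i) d x &
    Z' (row i M' - x *m X)])) => i.
  have [x hx yx] := surj _ (hP i).
  (* The lift x may be inhomogeneous. Its component of degree a i is again a lift, because row i of
     M' is homogeneous of that degree. *)
  exists (hcomp d (a i) x); split; [exact: (gsubH gP)|exact: hmx_hcomp|].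
  have := gsubH gZ' (a i) yx.
  rewrite hcompD hcompN (hcompM _ _ hX).
  by rewrite (hcomp_hmx _ (hmx_row (k := i) hM)) eqxx.
have MM' w : Z' (w *m M' - w *m M *m X).
  rewrite -mulmxA -mulmxBr; apply: (gsub_mulmx gZ') => i.
  by have [_ _] := hMP i; rewrite linearB /= row_mul.
have MP w : P (w *m M).
  by apply: (gsub_mulmx gP) => i; have [] := hMP i.
exists q, a, M; split.
  split=> // [|i|x hx].
  - by apply: hmx_rowP => i; have [_ ] := hMP i.
  - by have [] := hMP i.
  have [w hw] := hg _ (im _ hx); exists w; apply/ker.
    by apply: (gsubB gP).
  rewrite mulmxBl -(subrK (w *m M') (x *m X)) -addrA.
  by apply: (gsubD gZ').
apply: reg_upto_eq hR => // w; rewrite ker //.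
by split; [exact: (gsub_subl gZ' (MM' w))|exact: (gsub_subr gZ' (MM' w))].
Qed.

End Iso.

End Regularity.

(** * Regularity in short exact sequences *)

Section ExactSequences.

Variables (K : fieldType) (m : nat).
Local Notation S := {mpoly K[m]}.

Lemma lsubmxE p q (v : 'rV[S]_(p + q)) : v *m col_mx 1%:M 0 = lsubmx v.
Proof. by rewrite -{1}(hsubmxK v) mul_row_col mulmx0 mulmx1 addr0. Qed.

Lemma rsubmxE p q (v : 'rV[S]_(p + q)) : v *m col_mx 0 1%:M = rsubmx v.
Proof. by rewrite -{1}(hsubmxK v) mul_row_col mulmx0 mulmx1 add0r. Qed.

Lemma hmx_lsub p q (d : 'I_p -> nat) (a : 'I_q -> nat) :
  hmx (dcat d a) d (col_mx 1%:M 0 : 'M[S]_(p + q, p)).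
Proof. by apply: hmx_col_mx; [exact: hmx1|exact: hmx0]. Qed.

Lemma hmx_rsub p q (d : 'I_p -> nat) (a : 'I_q -> nat) :
  hmx (dcat d a) a (col_mx 0 1%:M : 'M[S]_(p + q, q)).
Proof. by apply: hmx_col_mx; [exact: hmx0|exact: hmx1]. Qed.

Lemma gsub_rsub0 p q (d : 'I_p -> nat) (a : 'I_q -> nat) :
  gsub (dcat d a) (fun v : 'rV[S]_(p + q) => rsubmx v = 0).
Proof.
apply: gsub_eq (gsub_preim (gsub_zero K m a) (@hmx_rsub _ _ d a)) => v.
by rewrite rsubmxE.
Qed.

Lemma mul_rsub0 p q s (v : 'rV[S]_(p + q)) (M : 'M_(p, s)) (N : 'M_(q, s)) :
  rsubmx v = 0 -> v *m col_mx M N = lsubmx v *m M.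
Proof. by move=> v0; rewrite -{1}(hsubmxK v) mul_row_col v0 mul0mx addr0. Qed.

Lemma reg_upto_zero k r p (d : 'I_p -> nat) :
  reg_upto k d (fun v : 'rV[S]_p => v = 0) (fun v => v = 0) r.
Proof.
elim: k r p d => [//|k IH] r p d; exists 0%N, (fun=> 0%N), 0; split.
  split=> [|[]|[]|x ->] //; first exact: hmx0.
  by exists 0; rewrite mul0mx subrr.
apply: reg_upto_eq (IH r.+1 0%N (fun=> 0%N)) => // v; rewrite mulmx0.
by split=> // _; apply/rowP; case.
Qed.

Lemma reg_upto_free k r p (d : 'I_p -> nat) :
  (forall i, (d i <= r)%N) ->
  reg_upto k d (fun _ : 'rV[S]_p => True) (fun v => v = 0) r.
Proof.
case: k => [//|k] dr; exists p, d, 1%:M; split.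
  split=> // [|x _]; first exact: hmx1.
  by exists x; rewrite mulmx1 subrr.
by apply: reg_upto_eq (reg_upto_zero k r.+1 d) => v; rewrite ?mulmx1.
Qed.

(* Horseshoe lemma: covers of Q / Z and of P / Q combine into one of P / Z,
   and the three kernels again form a short exact sequence. *)
Lemma reg_upto_ext k r p (d : 'I_p -> nat) (P Q Z : 'rV[S]_p -> Prop) :
  gsub d P -> gsub d Q -> gsub d Z ->
  (forall v, Z v -> Q v) -> (forall v, Q v -> P v) ->
  reg_upto k d Q Z r -> reg_upto k d P Q r -> reg_upto k d P Z r.
Proof.
elim: k r p d P Q Z => [//|k IH] r p d P Q Z gP gQ gZ ZQ QP.
move=> [qa [a [A [[hA ar hQA genA] RA]]]].
move=> [qc [c [C [[hC cr hPC genC] RC]]]].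
have hAC : hmx (dcat a c) d (col_mx A C) by exact: hmx_col_mx.
exists (qa + qc)%N, (dcat a c), (col_mx A C); split.
  split=> // [i|i|x hx].
  - by rewrite /dcat; case: (split i).
  - case: (split_ordP i) => j ->; first by rewrite rowKu; apply: QP.
    by rewrite rowKd.
  - have [w hw] := genC _ hx; have [u hu] := genA _ hw.
    by exists (row_mx u w); rewrite mul_row_col (addrC (u *m A)) opprD addrA.
have gN := gsub_preim gZ hAC.
(* N0 is the kernel of the cover A, embedded by w -> (w, 0); the quotient of the full kernel by N0
   is the kernel of the cover C. *)
pose N0 (w : 'rV_(qa + qc)) := Z (w *m col_mx A C) /\ rsubmx w = 0.
have gN0 : gsub (dcat a c) N0 by exact: gsubI gN (gsub_rsub0 _ _).
have g0 n (b : 'I_n -> nat) := gsub_zero K m b.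
apply: (IH _ _ _ _ N0 _ gN gN0 (g0 _ _)) => [v ->|v []//||].
- by split; rewrite ?mul0mx ?linear0 //; exact: (gsub0 gZ).
- apply: (@reg_upto_image _ _ _ _ a _ _ _ _ _ (row_mx 1%:M 0)) RA => //.
  + exact: gsub_preim hA.
  + by move=> v ->; rewrite mul0mx; exact: (gsub0 gZ).
  split=> [|w hw|w _|w [hw w0]].
  + by apply: hmx_row_mx; [exact: hmx1|exact: hmx0].
  + rewrite mul_mx_row mulmx1 mulmx0; split; last by rewrite row_mxKr.
    by rewrite mul_row_col mul0mx addr0.
  + rewrite mul_mx_row mulmx1 mulmx0; split=> [->|]; first by rewrite row_mx0.
    by rewrite -row_mx0 => /eq_row_mx[].
  + exists (lsubmx w); first by rewrite -(mul_rsub0 A C w0).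
    by rewrite mul_mx_row mulmx1 mulmx0 -{1}(hsubmxK w) w0 subrr.
- apply: (@reg_upto_preimage _ _ _ _ (dcat a c) _ _ c
    (fun w => Q (w *m C)) _ (col_mx 0 1%:M)) RC => //.
  split=> [|w hw|w hw|w hw]; rewrite ?rsubmxE.
  + exact: hmx_rsub.
  + have : Q (w *m col_mx A C) by exact: ZQ.
    rewrite -{1}(hsubmxK w) mul_row_col addrC => h.
    rewrite -(addrK (lsubmx w *m A) (_ *m C)); apply: (gsubB gQ) => //.
    exact: (gsub_mulmx gQ).
  + by split=> [[]|] //; split.
  (* A relation w of C modulo Q gives w C = u A modulo Z, so (- u, w) is a relation of the combined
     cover lifting w. *)
  + have [u hu] := genA _ hw.
    exists (row_mx (- u) w); last by rewrite rsubmxE row_mxKr subrr.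
    by rewrite mul_row_col mulNmx addrC.
Qed.

(** A cover of P / Z also covers P / Q, and its kernel over P / Q is an extension of Q / Z by its
    kernel over P / Z. Both have bound r + 1, so [reg_upto_ext] applies one step further. *)
Lemma reg_upto_quot k r p (d : 'I_p -> nat) (P Q Z : 'rV[S]_p -> Prop) :
  gsub d P -> gsub d Q -> gsub d Z ->
  (forall v, Z v -> Q v) -> (forall v, Q v -> P v) ->
  reg_upto k d P Z r -> reg_upto k d Q Z r.+1 -> reg_upto k d P Q r.
Proof.
move=> gP gQ gZ ZQ QP; case: k => [//|k] [q [a [M [[hM ar hPM gen] RZ]]]] RQ.
exists q, a, M; split.
  by split=> // x /gen[w hw]; exists w; apply: ZQ.
have g0 n (b : 'I_n -> nat) := gsub_zero K m b.
have gNQ := gsub_preim gQ hM; have gNZ := gsub_preim gZ hM.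
apply: (reg_upto_ext gNQ gNZ (g0 _ _)) => // [v ->|v|].
- by rewrite mul0mx; apply: (gsub0 gZ).
- exact: ZQ.
- apply: (@reg_upto_preimage _ _ _ _ a _ _ d Q Z M) => //.
    split=> // y hy; have [w hw] := gen _ (QP _ hy).
    by exists w => //; apply: (gsub_subl gQ) hy; apply: ZQ.
  by apply: reg_upto_mono RQ.
Qed.

(* With F the cover of P / Q, the fibre product of P / Z and F over P / Q is an
   extension of P / Z by the kernel of F -> P / Q, and Q / Z is its quotient by
   the graph of a lift of F -> P / Q. *)
Lemma reg_upto_sub k r p (d : 'I_p -> nat) (P Q Z : 'rV[S]_p -> Prop) :
  gsub d P -> gsub d Q -> gsub d Z ->
  (forall v, Z v -> Q v) -> (forall v, Q v -> P v) ->
  reg_upto k d P Z r.+1 -> reg_upto k.+1 d P Q r -> reg_upto k d Q Z r.+1.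
Proof.
move=> gP gQ gZ ZQ QP RZ [q [a [M [[hM ar hPM gen] RQ]]]].
pose D := col_mx 1%:M (- M).
have DE v : v *m D = lsubmx v - rsubmx v *m M.
  by rewrite -{1}(hsubmxK v) mul_row_col mulmx1 mulmxN.
have hD : hmx (dcat d a) d D.
  by apply: hmx_col_mx; [exact: hmx1|exact: hmxN].
have gL (N : 'rV[S]_p -> Prop) : gsub d N ->
    gsub (dcat d a) (fun v : 'rV_(p + q) => N (lsubmx v)).
  move=> gN; apply: gsub_eq (gsub_preim gN (@hmx_lsub _ _ d a)) => v.
  by rewrite lsubmxE.
have gR (N : 'rV[S]_q -> Prop) : gsub a N ->
    gsub (dcat d a) (fun v : 'rV_(p + q) => N (rsubmx v)).
  move=> gN; apply: gsub_eq (gsub_preim gN (@hmx_rsub _ _ d a)) => v.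
  by rewrite rsubmxE.
(* P2 / Z2 is the fibre product, N2 / Z2 the kernel of its projection to P / Z, and G2 / Z2 the
   graph of the lift w -> w M. The map [D], (x, w) -> x - w M, identifies P2 / G2 with Q / Z. *)
pose P2 (v : 'rV_(p + q)) := P (lsubmx v) /\ Q (v *m D).
pose Z2 (v : 'rV_(p + q)) := Z (lsubmx v) /\ rsubmx v = 0.
pose N2 (v : 'rV_(p + q)) := Z (lsubmx v) /\ Q (rsubmx v *m M).
pose G2 (v : 'rV_(p + q)) := P2 v /\ Z (v *m D).
have gP2 : gsub (dcat d a) P2.
  exact: gsubI (gL _ gP) (gsub_preim gQ hD).
have gZ2 : gsub (dcat d a) Z2.
  exact: gsubI (gL _ gZ) (gR _ (gsub_zero K m a)).
have gN2 : gsub (dcat d a) N2.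
  exact: gsubI (gL _ gZ) (gR _ (gsub_preim gQ hM)).
have gG2 : gsub (dcat d a) G2.
  exact: gsubI gP2 (gsub_preim gZ hD).
have ZP v : Z v -> P v by move=> /ZQ/QP.
have MP w : P (w *m M) by exact: (gsub_mulmx gP).
have Z2N2 v : Z2 v -> N2 v.
  by case=> h h0; split=> //; rewrite h0 mul0mx; apply: (gsub0 gQ).
have N2P2 v : N2 v -> P2 v.
  move=> [h1 h2]; split; first exact: ZP.
  by rewrite DE; apply: (gsubB gQ) => //; apply: ZQ.
have Z2G2 v : Z2 v -> G2 v.
  move=> h; split; first exact/N2P2/Z2N2.
  by case: h => h h0; rewrite DE h0 mul0mx subr0.
have gE : hmx a (dcat d a) (row_mx M 1%:M).
  by apply: hmx_row_mx => //; exact: hmx1.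
have gE0 : hmx a (dcat d a) (row_mx 0 1%:M : 'M[S]_(q, p + q)).
  by apply: hmx_row_mx; [exact: hmx0|exact: hmx1].
have R2 : reg_upto k (dcat d a) P2 Z2 r.+1.
  apply: (reg_upto_ext gP2 gN2 gZ2) => //.
    apply: (@reg_upto_image _ _ _ _ a _ _ _ _ _ (row_mx 0 1%:M)) RQ => //.
    - exact: gsub_preim hM.
    - by move=> v ->; rewrite mul0mx; apply: (gsub0 gQ).
    split=> // [w hw|w _|v [h1 h2]]; rewrite ?mul_mx_row ?mulmx0 ?mulmx1.
    - by split; rewrite ?row_mxKl ?row_mxKr //; apply: (gsub0 gZ).
    - rewrite /Z2 row_mxKl row_mxKr; split=> [->|[]//].
      by split=> //; apply: (gsub0 gZ).
    - exists (rsubmx v) => //; rewrite mul_mx_row mulmx0 mulmx1 /Z2 !linearB /=.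
      by rewrite row_mxKl row_mxKr subr0 subrr.
  apply: (@reg_upto_preimage _ _ _ _ (dcat d a) _ _ d _ _ (col_mx 1%:M 0)) RZ
    => //.
  split=> [|v [h _]|v [h1 h2]|x hx]; rewrite ?lsubmxE //.
  - exact: hmx_lsub.
  - split=> [[]//|h]; split=> //; have := gsubB gQ (ZQ _ h) h2.
    by rewrite DE opprB addrC subrK.
  - have [w hw] := gen _ hx; exists (row_mx x w).
      by rewrite /P2 DE row_mxKl row_mxKr.
    by rewrite lsubmxE row_mxKl subrr; apply: (gsub0 gZ).
(* The graph is free on the generators of the cover, in degrees at most r; r + 2 is merely the form
   in which [reg_upto_quot] takes the bound. *)
have RG : reg_upto k (dcat d a) G2 Z2 r.+2.
  have F := @reg_upto_free k r.+2 q a (fun i => leqW (leqW (ar i))).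
  apply: (@reg_upto_image _ _ _ _ a _ _ _ _ _ (row_mx M 1%:M)) F => //.
  split=> // [w _|w _|v [[h1 h2] h3]].
  - rewrite mul_mx_row mulmx1 /G2 /P2 DE row_mxKl row_mxKr subrr.
    by split; [split=> //; apply: (gsub0 gQ)|apply: (gsub0 gZ)].
  - rewrite mul_mx_row mulmx1 /Z2 row_mxKl row_mxKr; split=> [->|[]//].
    by rewrite mul0mx; split=> //; apply: (gsub0 gZ).
  - exists (rsubmx v) => //; rewrite mul_mx_row mulmx1 /Z2 !linearB /=.
    by rewrite row_mxKl row_mxKr subrr -DE.
have RPG := reg_upto_quot gP2 gG2 gZ2 Z2G2 (fun v h => proj1 h) R2 RG.
apply: (@reg_upto_image _ _ _ _ (dcat d a) _ _ _ _ _ D) RPG => //.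
  by move=> v [].
split=> // [v []//|v h|y hy]; first by split=> [[]|].
exists (row_mx y 0); last first.
  by rewrite DE row_mxKl row_mxKr mul0mx subr0 subrr; apply: (gsub0 gZ).
by rewrite /P2 DE row_mxKl row_mxKr mul0mx subr0; split=> //; apply: QP.
Qed.

Lemma reg_upto_shift k r p (d : 'I_p -> nat) (P Z : 'rV[S]_p -> Prop) :
  reg_upto k d P Z r -> reg_upto k (fun i => (d i).+1) P Z r.+1.
Proof.
elim: k r p d P Z => [//|k IH] r p d P Z [q [a [M [[hM ar hP gen] R]]]].
exists q, (fun i => (a i).+1), M; split; last exact: IH.
by split=> // i j u /hM; rewrite addnS => ->.
Qed.

End ExactSequences.

(** * Minimal resolutions *)

Section MinimalResolution.

Variables (K : fieldType) (m : nat).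
Local Notation S := {mpoly K[m]}.

(** The kernel lies in (X_1, ..., X_m) F. The rows of the next matrix in the resolution belong to
    this kernel, which yields [mgr_minimal]. *)
Definition minimal_cover p (Z : 'rV[S]_p -> Prop) q (M : 'M[S]_(q, p)) :=
  forall w, Z (w *m M) -> forall i, (w 0 i)@_0%MM = 0.

Lemma mulmx_row' p q (M : 'M[S]_(q.+1, p)) (v : 'rV_q.+1) i :
  v 0 i = 0 -> v *m M = col' i v *m row' i M.
Proof.
move=> v0; apply/rowP => l; rewrite !mxE (bigD1_ord i) //= v0 mul0r add0r.
by apply: eq_bigr => j _; rewrite !mxE.
Qed.

(* A relation with a unit coefficient makes the corresponding generator
   redundant. *)
Lemma cover_drop p (d : 'I_p -> nat) (P Z : 'rV[S]_p -> Prop) r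
    q (a : 'I_q.+1 -> nat) (M : 'M_(q.+1, p)) w i :
  gsub d Z -> graded_cover d P Z r a M -> Z (w *m M) -> (w 0 i)@_0%MM != 0 ->
  graded_cover d P Z r (fun j => a (lift i j)) (row' i M).
Proof.
move=> gZ [hM ar hP gen] hw wi.
(* Cutting the relation down to degree a i turns its i-th entry into the nonzero constant c, which
   can be inverted. *)
have hw' := gsubH gZ (a i) hw; rewrite (hcompM _ _ hM) in hw'.
set w' := hcomp a (a i) w in hw'.
pose c := (w 0 i)@_0%MM.
have w'i : w' 0 i = c%:MP.
  apply/mpolyP => u; rewrite mcoeff_hcomp mcoeffC.
  rewrite -[in X in _ == X](add0n (a i)) eqn_add2r mdeg_eq0.
  by case: eqP => [->|_]; rewrite ?mulr1 ?mulr0.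
clearbody w'; split=> [k l|j|j|x hx].
- by rewrite mxE; exact: hM.
- exact: ar.
- suff -> : row j (row' i M) = row (lift i j) M by exact: hP.
  by apply/rowP => l; rewrite !mxE.
have [v hv] := gen _ hx.
pose u := v - (v 0 i * (c^-1)%:MP) *: w'.
have ui : u 0 i = 0.
  by rewrite /u !mxE w'i -mulrA -mpolyCM mulVf // mpolyC1 mulr1 subrr.
exists (col' i u); rewrite -(mulmx_row' M ui) mulmxBl opprB addrA addrAC.
by apply: (gsubD gZ) => //; rewrite -scalemxAl; apply: (gsubZ gZ).
Qed.

Lemma minimal_cover_exists p (d : 'I_p -> nat) (P Z : 'rV[S]_p -> Prop) r
    q (a : 'I_q -> nat) (M : 'M_(q, p)) :
  gsub d Z -> graded_cover d P Z r a M ->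
  exists q (a : 'I_q -> nat) (M : 'M_(q, p)),
    graded_cover d P Z r a M /\ minimal_cover Z M.
Proof.
move=> gZ; elim: q a M => [|q IH] a M cM.
  by exists 0%N, a, M; split=> // w _ [].
have [mM|nM] := classic (minimal_cover Z M); first by exists q.+1, a, M.
have [w wM] := not_all_ex_not _ _ nM.
have [hw /not_all_ex_not[i /eqP wi]] := imply_to_and _ _ wM.
exact: IH (cover_drop gZ cM hw wi).
Qed.

(** The cover identifies P / Z with the quotient of a free module F by the kernel, and F is
    generated in degrees at most r, so [reg_upto_sub] bounds the kernel. The cover is arbitrary, so
    a minimal one can be taken at every step at no cost in degrees. *)
Lemma reg_upto_kernel p (d : 'I_p -> nat) (P Z : 'rV[S]_p -> Prop) r
    q (a : 'I_q -> nat) (M : 'M_(q, p)) :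
  gsub d P -> gsub d Z -> (forall v, Z v -> P v) -> graded_cover d P Z r a M ->
  (forall k, reg_upto k d P Z r) ->
  forall k, reg_upto k a (fun w => Z (w *m M)) (fun w => w = 0) r.+1.
Proof.
move=> gP gZ ZP [hM ar hP gen] R k; have gN := gsub_preim gZ hM.
apply: (reg_upto_sub (gsub_full K m a) gN (gsub_zero K m a)) => //.
- by move=> v ->; rewrite mul0mx; apply: (gsub0 gZ).
- by apply: reg_upto_free => i; apply: leqW.
apply: (reg_upto_preimage (gsub_full K m a) gZ (X := M) (P' := P)) => //.
split=> // [w _|y hy]; first exact: (gsub_mulmx gP).
by have [w hw] := gen _ hy; exists w.
Qed.

(** Bundling the bound for all truncations with the module makes [syzygy] an endofunction that can
    be iterated. Covers exist only in Prop, hence the choice by [epsilon]. *)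
Record gmodule := GModule {
  gm_rank : nat;
  gm_deg : 'I_gm_rank -> nat;
  gm_num : 'rV[S]_gm_rank -> Prop;
  gm_den : 'rV[S]_gm_rank -> Prop;
  gm_reg : nat;
  gm_gnum : gsub gm_deg gm_num;
  gm_gden : gsub gm_deg gm_den;
  gm_sub : forall v, gm_den v -> gm_num v;
  gm_regP : forall k, reg_upto k gm_deg gm_num gm_den gm_reg }.

Record min_cover (G : gmodule) := MinCover {
  mc_rank : nat;
  mc_deg : 'I_mc_rank -> nat;
  mc_mx : 'M[S]_(mc_rank, gm_rank G);
  mc_cover : graded_cover (@gm_deg G) (@gm_num G) (@gm_den G) (gm_reg G)
    mc_deg mc_mx;
  mc_min : minimal_cover (@gm_den G) mc_mx }.

Lemma min_cover_inh (G : gmodule) : inhabited (min_cover G).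
Proof.
have [q [a [M [cM _]]]] := gm_regP G 1.
have [q' [a' [M' [cM' mM']]]] := minimal_cover_exists (gm_gden G) cM.
by split; exists q' a' M'.
Qed.

Definition min_cover_of (G : gmodule) : min_cover G :=
  epsilon (min_cover_inh G) (fun=> True).

Definition syzygy (G : gmodule) : gmodule :=
  let C := min_cover_of G in
  @GModule (mc_rank C) (@mc_deg G C) (fun w => gm_den (w *m mc_mx C))
    (fun w => w = 0) (gm_reg G).+1
    (gsub_preim (gm_gden G) (cover_hmx (mc_cover C)))
    (gsub_zero K m (@mc_deg G C))
    (fun v v0 => eq_ind_r (fun v => gm_den (v *m mc_mx C))
      (eq_ind_r (@gm_den G) (gsub0 (gm_gden G)) (mul0mx _ _)) v0)
    (reg_upto_kernel (gm_gnum G) (gm_gden G) (@gm_sub G) (mc_cover C) (gm_regP G)).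

Definition syz (G : gmodule) (i : nat) : gmodule := iter i syzygy G.

Lemma gm_reg_syz G i : gm_reg (syz G i) = (gm_reg G + i)%N.
Proof. by elim: i => [|i IH]; rewrite ?addn0 //= -/(syz G i) IH addnS. Qed.

Section Ideal.

Variables (J : S -> Prop) (r : nat).
Let d0 (i : 'I_1) := 0%N.
Hypothesis gJ : gsub d0 (fun v => J (v 0 0)).
Hypothesis regJ :
  forall k, reg_upto k d0 (fun=> True) (fun v : 'rV_1 => J (v 0 0)) r.

Definition quotient_module : gmodule :=
  @GModule 1 d0 (fun=> True) (fun v => J (v 0 0)) r (gsub_full K m d0) gJ
    (fun v _ => I) regJ.

Local Notation C i := (min_cover_of (syz quotient_module i)).

Lemma resolution_exists :
  exists F : min_graded_resolution J,
    forall i k, (mgr_deg F i k <= r + i)%N.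
Proof.
have exactC i (v : 'rV_(mc_rank (C i))) :
    gm_den (v *m mc_mx (C i)) <->
    exists w, v = w *m (mc_mx (C i.+1) : 'M_(_, mc_rank (C i))).
  split=> [hv|[w ->]].
    have [w hw] := cover_gen (mc_cover (C i.+1)) hv.
    by exists w; apply/eqP; rewrite -subr_eq0; apply/eqP.
  exact: (gsub_mulmx (gm_gnum (syz quotient_module i.+1)) w
    (cover_row (mc_cover (C i.+1)))).
unshelve eexists (@MinGradedResolution K m J (fun i => mc_rank (C i))
  (fun i => @mc_deg _ (C i)) (mc_mx (C 0%N)) (fun i => mc_mx (C i.+1))
  _ _ _ _ _ _).
- move=> k u hu.
  by have := cover_hmx (mc_cover (C 0%N)) hu; rewrite addn0.
- by move=> i k l u; apply: (cover_hmx (mc_cover (C i.+1))).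
- move=> p; have [w hw] := cover_gen (mc_cover (C 0%N)) (x := p%:M) I.
  by exists w; move: hw; rewrite /= !mxE mulr1n.
- exact: (exactC 0%N).
- by move=> i; apply: (exactC i.+1).
- move=> i k l.
  have := mc_min (cover_row (mc_cover (C i.+1)) k) l.
  by rewrite mxE.
- move=> i k /=; have := cover_deg (mc_cover (C i)) k.
  by rewrite gm_reg_syz.
Qed.

End Ideal.

Lemma int_max (A : int -> Prop) (x r : int) :
  A x -> (forall y, A y -> y <= r) ->
  exists2 z, A z & forall y, A y -> y <= z.
Proof.
move=> Ax Ar; have [n] : exists n : nat, r - x <= n.
  by exists `|r - x|%N; rewrite abszE ler_norm.
elim: n x Ax => [|n IH] x Ax.
  rewrite subr_le0 => rx; exists x => // y /Ar yr; exact: le_trans rx.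
move=> rn; have [mx|] := classic (forall y, A y -> y <= x); first by exists x.
move=> /not_all_ex_not[y Ayx]; have [Ay /negP] := imply_to_and _ _ Ayx.
rewrite -ltNge => xy.
apply: (IH y Ay); apply: (@le_trans _ _ (r - (x + 1))).
  by rewrite lerD2l lerN2 lezD1.
by rewrite opprD addrA lerBlDr -(PoszD n 1) addn1.
Qed.

(** The degree bound makes the set of values j - i bounded above, and 1 outside J makes F_0 nonzero
    and that set nonempty; together they give a maximum. *)
Lemma regularity_le (J : S -> Prop) (r : nat) :
  gsub (fun=> 0%N) (fun v : 'rV_1 => J (v 0 0)) -> ~ J 1 ->
  (forall k, reg_upto k (fun=> 0%N) (fun=> True)
     (fun v : 'rV_1 => J (v 0 0)) r) ->
  exists r' : int, is_regularity J r' /\ r' <= r%:Z.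
Proof.
move=> gJ J1 regJ; have [F Fr] := resolution_exists gJ regJ.
pose A x := exists i j : nat, graded_betti F i j <> 0%N /\ j%:Z - i%:Z = x.
have Ar x : A x -> x <= r%:Z.
  move=> [i [j [/eqP + <-]]]; rewrite cards_eq0 => /set0Pn[k].
  rewrite inE => /eqP <-; rewrite lerBlDr -PoszD lez_nat; exact: Fr.
have rk : (0 < mgr_rank F 0)%N.
  rewrite lt0n; apply/eqP => rk0; have [v] := mgr_aug_surj F 1.
  rewrite mxE big1 ?subr0 // => i _.
  by have := ltn_ord i; rewrite [X in (_ < X)%N]rk0.
pose k := Ordinal rk.
have A0 : A (mgr_deg F 0 k)%:Z.
  exists 0%N, (mgr_deg F 0 k); rewrite subr0; split=> //.
  by apply/eqP; rewrite cards_eq0; apply/set0Pn; exists k; rewrite inE.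
have [z Az zmax] := int_max A0 Ar.
exists z; split; last exact: Ar.
exists F; split=> // i j h; apply: zmax; by exists i, j.
Qed.

End MinimalResolution.

(** * Ideals given by generators *)

Section Ideals.

Variables (K : fieldType) (m : nat).
Local Notation S := {mpoly K[m]}.
Implicit Types (G H : S -> Prop) (p q g : S) (z : 'I_m).

Inductive idl G : S -> Prop :=
| idl0 : idl G 0
| idl_add a g p of G g & idl G p : idl G (a * g + p).

Lemma idl_gen G g : G g -> idl G g.
Proof. by move=> /(@idl_add G 1 g 0)/(_ (idl0 G)); rewrite mul1r addr0. Qed.

Lemma idlD G p q : idl G p -> idl G q -> idl G (p + q).
Proof.
move=> hp hq; elim: hp => [|a g p' hg _ IH]; first by rewrite add0r.
by rewrite -addrA; apply: idl_add.
Qed.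

Lemma idlMl G a p : idl G p -> idl G (a * p).
Proof.
elim=> [|b g p' hg _ IH]; first by rewrite mulr0; exact: idl0.
by rewrite mulrDr mulrA; apply: idl_add.
Qed.

Lemma idlMr G a p : idl G p -> idl G (p * a).
Proof. by rewrite mulrC; exact: idlMl. Qed.

Lemma idlN G p : idl G p -> idl G (- p).
Proof. by rewrite -mulN1r; exact: idlMl. Qed.

Lemma idlB G p q : idl G p -> idl G q -> idl G (p - q).
Proof. by move=> hp hq; apply: idlD => //; apply: idlN. Qed.

Lemma idl_sum G (I : Type) (s : seq I) (P : pred I) (F : I -> S) :
  (forall i, P i -> idl G (F i)) -> idl G (\sum_(i <- s | P i) F i).
Proof. by move=> h; elim/big_ind: _ => //; [exact: idl0|exact: idlD]. Qed.

Lemma idl_le G H : (forall g, G g -> idl H g) -> forall p, idl G p -> idl H p.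
Proof.
move=> GH p; elim=> [|a g q hg _ IH]; first exact: idl0.
by apply: idlD IH; apply/idlMl/GH.
Qed.

Lemma gsub_idl G (d : 'I_1 -> nat) :
  (forall g, G g -> exists a, ehomog a (d 0) g) ->
  gsub d (fun v : 'rV[S]_1 => idl G (v 0 0)).
Proof.
move=> hG; split=> [|u v hu hv|a u hu|j u].
- by rewrite mxE; exact: idl0.
- by rewrite mxE; exact: idlD.
- by rewrite mxE; exact: idlMl.
rewrite [u in hcomp _ _ u]mx11_scalar; elim=> [|a g q hg _ IH].
  by rewrite raddf0 hcomp0 mxE; exact: idl0.
rewrite raddfD hcompD mxE; apply: idlD IH.
have [e he] := hG _ hg.
have hgM : hmx (fun=> e) d (g%:M : 'M_1).
  by move=> k l; rewrite !ord1 mxE eqxx.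
rewrite /= scalar_mxM (hcompM _ _ hgM) mxE big_ord1 [g%:M _ _]mxE eqxx.
exact/idlMl/idl_gen.
Qed.

Definition free_of z p := forall u, u \in msupp p -> u z = 0%N.

Lemma free_of0 z : free_of z 0.
Proof. by move=> u; rewrite msupp0. Qed.

Lemma free_ofD z p q : free_of z p -> free_of z q -> free_of z (p + q).
Proof.
by move=> hp hq u /msuppD_le; rewrite mem_cat => /orP[]; [exact: hp|exact: hq].
Qed.

Lemma free_ofN z p : free_of z p -> free_of z (- p).
Proof. by move=> hp u; rewrite (perm_mem (msuppN _)); exact: hp. Qed.

Lemma free_ofM z p q : free_of z p -> free_of z q -> free_of z (p * q).
Proof.
move=> hp hq u /msuppM_le /allpairsP[[u1 u2] /= [h1 h2 ->]].
by rewrite mnmDE (hp _ h1) (hq _ h2).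
Qed.

Lemma free_ofX z w : w != z -> free_of z 'X_w.
Proof.
by move=> wz u; rewrite msuppX inE => /eqP->; rewrite mnm1E (negbTE wz).
Qed.

(* Euclidean division by a variable: p = 'X_z * vdiv z p + kill z p with
   kill z p not involving 'X_z. *)
Definition vdiv z p : S :=
  \sum_(u : 'X_{1..m < msize p}) p@_(u + U_(z)) *: 'X_[u].

Definition kill z p : S := p - 'X_z * vdiv z p.

Lemma mcoeff_vdiv z p u : (vdiv z p)@_u = p@_(u + U_(z)).
Proof.
have [lt|ge] := ltnP (mdeg u) (msize p).
  by rewrite (mcoeff_mpoly (fun u => p@_(u + U_(z))) lt).
rewrite memN_msupp_eq0; last first.
  apply/negP; rewrite mcoeff_msupp raddf_sum /= big1 ?eqxx // => w _.
  rewrite mcoeffZ mcoeffX; case: eqP => [wu|_]; last by rewrite mulr0.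
  by have := bmdeg w; rewrite wu ltnNge ge.
rewrite memN_msupp_eq0 //; apply: msize_mdeg_ge.
by rewrite mdegD; apply: leq_trans (leq_addr _ _).
Qed.

Lemma vdivD z p q : vdiv z (p + q) = vdiv z p + vdiv z q.
Proof. by apply/mpolyP => u; rewrite mcoeffD !mcoeff_vdiv mcoeffD. Qed.

Lemma vdivX z p : vdiv z ('X_z * p) = p.
Proof. by apply/mpolyP => u; rewrite mcoeff_vdiv mulrC addmC mcoeffMX. Qed.

Lemma vdiv_free z p : free_of z p -> vdiv z p = 0.
Proof.
move=> hp; apply/mpolyP => u; rewrite mcoeff_vdiv mcoeff0.
apply: memN_msupp_eq0; apply/negP => /hp.
by rewrite mnmDE mnm1E eqxx addn1.
Qed.

Lemma free_of_kill z p : free_of z (kill z p).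
Proof.
move=> u; rewrite mcoeff_msupp mcoeffB => h; apply/eqP; apply: contraNT h.
rewrite -lep1mP => uz.
have -> : u = (U_(z) + (u - U_(z)))%MM by rewrite addmC submK.
by rewrite mulrC mcoeffMX mcoeff_vdiv addmC subrr.
Qed.

Lemma kill_vdiv z p : p = 'X_z * vdiv z p + kill z p.
Proof. by rewrite addrC subrK. Qed.

Lemma vdiv_kill_uniq z p q s :
  p = 'X_z * q + s -> free_of z s -> vdiv z p = q /\ kill z p = s.
Proof.
move=> e hs; have eq : vdiv z p = q by rewrite e vdivD vdivX vdiv_free ?addr0.
by split=> //; rewrite /kill eq e addrC addKr.
Qed.

Lemma killX z p : kill z ('X_z * p) = 0.
Proof. by rewrite /kill vdivX subrr. Qed.

Lemma kill_free z p : free_of z p -> kill z p = p.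
Proof. by move=> hp; rewrite /kill vdiv_free // mulr0 subr0. Qed.

Lemma killD z p q : kill z (p + q) = kill z p + kill z q.
Proof. by rewrite /kill vdivD mulrDr opprD addrACA. Qed.

Lemma kill0 z : kill z 0 = 0.
Proof. by have := killX z 0; rewrite mulr0. Qed.

Lemma kill_sum z (I : Type) (s : seq I) (P : pred I) (F : I -> S) :
  kill z (\sum_(i <- s | P i) F i) = \sum_(i <- s | P i) kill z (F i).
Proof. by apply: (big_morph _ (@killD z) (kill0 z)). Qed.

Lemma killM z p q : kill z (p * q) = kill z p * kill z q.
Proof.
have e : p * q = 'X_z * (vdiv z p * q + kill z p * vdiv z q)
    + kill z p * kill z q.
  by rewrite /kill; ring.
have [] // := vdiv_kill_uniq e.
by apply: free_ofM; exact: free_of_kill.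
Qed.

(** If g does not involve 'X_z, dividing a * g by 'X_z only divides a. Hence 'X_z is a
    nonzerodivisor modulo such an ideal, which is [idl_nzd]. *)
Lemma idl_kill G z p : (forall g, G g -> free_of z g) ->
  idl G p -> idl G (kill z p) /\ idl G (vdiv z p).
Proof.
move=> hG; elim=> [|a g q hg _ [IH1 IH2]].
  by rewrite kill0 vdiv_free; [split; exact: idl0|exact: free_of0].
have e : a * g = 'X_z * (vdiv z a * g) + kill z a * g.
  by rewrite /kill; ring.
have [e1 e2] := vdiv_kill_uniq e (free_ofM (@free_of_kill z a) (hG _ hg)).
by rewrite killD vdivD e1 e2; split; apply: idl_add.
Qed.

Lemma idl_nzd G z p : (forall g, G g -> free_of z g) ->
  idl G ('X_z * p) -> idl G p.
Proof. by move=> hG /(idl_kill hG)[_]; rewrite vdivX. Qed.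

Definition reg_idl G r :=
  forall k, reg_upto k (fun=> 0%N) (fun=> True)
    (fun v : 'rV[S]_1 => idl G (v 0 0)) r.

Definition homog_gens G := forall g, G g -> exists a, ehomog a 0 g.

Definition add_var G z g := G g \/ g = 'X_z.

Lemma homog_add_var G z : homog_gens G -> homog_gens (add_var G z).
Proof. by move=> hG g [/hG //|->]; exists 1%N; exact: ehomogX. Qed.

Lemma ext_idl G z p : idl (add_var G z) p -> exists a, idl G (p - a * 'X_z).
Proof.
elim=> [|a g q [hg|->] _ [b hb]].
- by exists 0; rewrite mul0r subrr; exact: idl0.
- by exists b; rewrite -addrA; apply: idl_add.
- by exists (a + b); rewrite mulrDl opprD addrACA subrr add0r.
Qed.

(** Multiplication by 'X_z maps S / G, shifted by one, isomorphically onto (G, 'X_z) / G, and the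
    quotient rule absorbs the shift. *)
Lemma reg_idl_add_var G z r : homog_gens G ->
  (forall g, G g -> free_of z g) -> reg_idl G r -> reg_idl (add_var G z) r.
Proof.
move=> hG fG R k.
have gG := @gsub_idl G (fun=> 0%N) hG.
have gGz := @gsub_idl _ (fun=> 0%N) (@homog_add_var G z hG).
have GGz p : idl G p -> idl (add_var G z) p.
  by apply: idl_le => g hg; apply: idl_gen; left.
apply: (reg_upto_quot (gsub_full K m _) gGz gG) => // [v|]; first exact: GGz.
apply: (reg_upto_image (gsub_full K m _) gG (X := ('X_z)%:M) _ _
  (reg_upto_shift (R k))) => //.
have XE (v : 'rV[S]_1) : (v *m ('X_z)%:M) 0 0 = v 0 0 * 'X_z.
  by rewrite mul_mx_scalar mxE mulrC.
split=> [i j|v _|v _|v /ext_idl[a ha]]; rewrite ?XE.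
- by rewrite !ord1 mxE eqxx; exact: ehomogX.
- by apply/idlMl/idl_gen; right.
- by split=> [|h]; [exact: idlMr|apply: (idl_nzd fG); rewrite mulrC].
- by exists a%:M; rewrite // mxE [X in _ + X]mxE XE [a%:M _ _]mxE eqxx.
Qed.

End Ideals.

(** * Binomial edge ideals *)

Section EdgeIdeals.

Variables (K : fieldType) (n : nat).
Local Notation S := {mpoly K[n + n]}.
Local Notation xv i := ('X_(lshift n i) : S).
Local Notation yv i := ('X_(rshift n i) : S).
Local Notation f i j := (edge_binomial K i j).
Implicit Types (i j k v : 'I_n) (A C : {set 'I_n}) (W : {set 'I_(n + n)}).
Implicit Types e : rel 'I_n.

(** This class of ideals is stable under all the recursions: only edges inside [A] count, and the
    variables in [W] are adjoined. *)
Definition bei_gens A W e (g : S) : Prop :=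
  (exists2 z, z \in W & g = 'X_z) \/
  (exists i j, [/\ i \in A, j \in A, e i j & g = f i j]).

Lemma fE i j : f i j = xv i * yv j - xv j * yv i.
Proof. by []. Qed.

Lemma fC i j : f i j = - f j i.
Proof. by rewrite !fE opprB. Qed.

Lemma homog_bei A W e : homog_gens (bei_gens A W e).
Proof.
move=> g [[z _ ->]|[i [j [_ _ _ ->]]]]; first by exists 1%N; exact: ehomogX.
exists 2%N; rewrite fE; apply: ehomogD; last apply: ehomogN.
  by apply: ehomogM; exact: ehomogX.
by apply: ehomogM; exact: ehomogX.
Qed.

Lemma gsub_bei A W e :
  gsub (fun=> 0%N) (fun v : 'rV[S]_1 => idl (bei_gens A W e) (v 0 0)).
Proof. exact: gsub_idl (@homog_bei A W e). Qed.

Lemma eq_lrshift i j : (lshift n i == rshift n j) = false.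
Proof. by apply/negbTE; rewrite -val_eqE /= neq_ltn ltn_addr. Qed.

Definition var_at v (z : 'I_(n + n)) := z = lshift n v \/ z = rshift n v.

Lemma free_of_var v z i : var_at v z -> i != v ->
  free_of z (xv i) /\ free_of z (yv i).
Proof.
move=> [->|->] iv; split; apply: free_ofX.
- by rewrite (inj_eq (@lshift_inj _ _)).
- by rewrite eq_sym eq_lrshift.
- by rewrite eq_lrshift.
- by rewrite (inj_eq (@rshift_inj _ _)).
Qed.

Lemma free_of_edge v z i j : var_at v z -> i != v -> j != v ->
  free_of z (f i j).
Proof.
move=> zv iv jv; have [Xi Yi] := free_of_var zv iv.
have [Xj Yj] := free_of_var zv jv.
by apply: free_ofD; last apply: free_ofN; apply: free_ofM.
Qed.

Lemma free_of_bei A W e v z : v \notin A -> z \notin W -> var_at v z ->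
  forall g, bei_gens A W e g -> free_of z g.
Proof.
move=> vA zW zv g [[w wW ->]|[i [j [iA jA _ ->]]]].
  by apply: free_ofX; apply: contraNneq zW => <-.
by apply: (free_of_edge zv); apply: contraNneq vA => <-.
Qed.

Lemma bei_var A W e z : z \in W -> idl (bei_gens A W e) 'X_z.
Proof. by move=> zW; apply: idl_gen; left; exists z. Qed.

Lemma bei_edge A W e i j : i \in A -> j \in A -> e i j ->
  idl (bei_gens A W e) (f i j).
Proof. by move=> *; apply: idl_gen; right; exists i, j. Qed.

Lemma bei_le A A' W W' e e' :
  A \subset A' -> W \subset W' -> subrel e e' ->
  forall p, idl (bei_gens A W e) p -> idl (bei_gens A' W' e') p.
Proof.
move=> /subsetP AA' /subsetP WW' ee'; apply: idl_le => g.
case=> [[z zW ->]|[i [j [iA jA eij ->]]]]; first by apply/bei_var/WW'.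
by apply: bei_edge; [exact: AA'|exact: AA'|exact: ee'].
Qed.

Lemma ext_vars A W C e p :
  idl (bei_gens A (W :|: [set lshift n i | i in C]) e) p ->
  exists b : 'I_n -> S, idl (bei_gens A W e) (p - \sum_(i in C) b i * xv i).
Proof.
elim=> [|a g q hg _ [b hb]].
  exists (fun=> 0); rewrite big1 ?subr0; first exact: idl0.
  by move=> i _; rewrite mul0r.
case: hg => [[z + ->]|[i [j [iA jA eij ->]]]].
  rewrite inE => /orP[zW|/imsetP[i iC ->]].
    by exists b; rewrite -addrA; apply: idlD hb; apply/idlMl/bei_var.
  exists (fun j => b j + if j == i then a else 0).
  under eq_bigr do rewrite mulrDl.
  rewrite big_split /= (bigD1 i iC (F := fun j => (if _ then _ else _) * _)) /=.
  rewrite eqxx [X in _ - (_ + (_ + X))]big1 => [|j /andP[_ /negbTE->]].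
    by rewrite addr0 (addrC (\sum_(_ in _) _)) opprD addrACA subrr add0r.
  by rewrite mul0r.
exists b; rewrite -addrA; apply: idlD hb; apply/idlMl; exact: bei_edge.
Qed.

Lemma reg_bei_vars e W : reg_idl (bei_gens set0 W e) 0.
Proof.
move: {2}#|W| (erefl #|W|) => N; elim: N W => [|N IH] W cW k.
  apply: reg_upto_eq (@reg_upto_free _ _ k 0 1 (fun=> 0%N) _) => // v.
  split=> [->|]; first by rewrite mxE; exact: idl0.
  suff h p : idl (bei_gens set0 W e) p -> p = 0.
    by move=> /h v0; apply/rowP => i; rewrite ord1 v0 mxE.
  elim=> // a g q hg _ ->; case: hg => [[z]|[i [j []]]]; last by rewrite inE.
  by move/eqP: cW; rewrite cards_eq0 => /eqP->; rewrite inE.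
have [z zW] : exists z, z \in W by apply/set0Pn; rewrite -cards_eq0 cW.
have cW' : #|W :\ z| = N by move: cW; rewrite (cardsD1 z) zW => -[].
apply: reg_upto_eq (@reg_idl_add_var K _ _ z 0 (@homog_bei _ _ e) _
  (IH _ cW') k).
- by [].
- move=> v; split; apply: idl_le => g.
    case=> [[[w]|[i [j []]]]|->]; rewrite ?inE //; last exact: bei_var.
    by case/andP=> _ wW ->; exact: bei_var.
  case=> [[w wW ->]|[i [j []]]]; last by rewrite inE.
  have [->|wz] := eqVneq w z; first by apply: idl_gen; right.
  by apply: idl_gen; left; left; exists w; rewrite // !inE wz.
- move=> g [[w]|[i [j []]]]; last by rewrite inE.
  by rewrite !inE => /andP[wz _] ->; exact: free_ofX.
Qed.

End EdgeIdeals.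

(** * Disjoint unions of cliques *)

Section DisjointCliques.

Variables (K : fieldType) (n : nat).
Local Notation S := {mpoly K[n + n]}.
Local Notation xv i := ('X_(lshift n i) : S).
Local Notation yv i := ('X_(rshift n i) : S).
Local Notation f i j := (edge_binomial K i j).
Local Notation I A W e := (idl (@bei_gens K n A W e)).

Definition off_vars (A : {set 'I_n}) (W : {set 'I_(n + n)}) :=
  forall i z, i \in A -> var_at i z -> z \notin W.

(** For symmetric e, the graph on A is a disjoint union of cliques; i != k excludes the walks i, j,
    i. *)
Definition trans_on (A : {set 'I_n}) (e : rel 'I_n) :=
  forall i j k, i \in A -> j \in A -> k \in A ->
    e i j -> e j k -> i != k -> e i k.

Section OneVertex.

Variables (A : {set 'I_n}) (W : {set 'I_(n + n)}) (e : rel 'I_n) (v : 'I_n).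
Hypotheses (e_sym : ssrbool.symmetric e) (e_trans : trans_on A e)
  (AW : off_vars A W) (vA : v \in A).

Let C := [set i in A | e v i && (i != v)].
Let A1 := A :\ v.
Let A2 := A1 :\: C.

Lemma nbr_edge i j : i \in C -> j \in C -> i != j -> e i j.
Proof.
rewrite !inE => /and3P[iA vi _] /and3P[jA vj _]; apply: (e_trans iA vA) => //.
by rewrite e_sym.
Qed.

Lemma nbr_closed i j : i \in A1 -> j \in A1 -> e i j -> (i \in C) = (j \in C).
Proof.
rewrite !inE => /andP[iv iA] /andP[jv jA] eij; rewrite iA jA iv jv !andbT.
apply/idP/idP => h; first by apply: (e_trans vA iA) => //; rewrite eq_sym.
by apply: (e_trans vA jA) => //; rewrite ?(e_sym j) // eq_sym.
Qed.

Lemma nbr_A1 i : i \in C -> i \in A1.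
Proof. by rewrite !inE => /and3P[-> _ ->]. Qed.

Lemma I_A2_A1 p : I A2 W e p -> I A1 W e p.
Proof. by apply: bei_le => //; exact: subsetDl. Qed.

(* The relations between the x_i, i in D, modulo I A2 W e are generated by the
   trivial ones. *)
Lemma swap_xy_nbr (D : {set 'I_n}) (u : 'I_n -> S) : D \subset C ->
  I A2 W e (\sum_(i in D) u i * xv i) -> I A1 W e (\sum_(i in D) u i * yv i).
Proof.
move: {2}#|D| (erefl #|D|) => N; elim: N D u => [|N IH] D u cD DC hu.
  move/eqP: cD; rewrite cards_eq0 => /eqP->.
  by rewrite big_set0; exact: idl0.
have [k kD] : exists k, k \in D by apply/set0Pn; rewrite -cards_eq0 cD.
have cD' : #|D :\ k| = N by move: cD; rewrite (cardsD1 k) kD => -[].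
have kC : k \in C by exact: (subsetP DC).
have DC' : D :\ k \subset C by apply: subset_trans DC; exact: subsetDl.
(* Modulo the other x_i with i in D, the relation reduces to u k * x_k. As x_k occurs in no
   generator, it cancels, so u k is a combination of these x_i modulo the ideal. *)
have [w hw] : exists w, I A2 W e (u k - \sum_(i in D :\ k) w i * xv i).
  apply: ext_vars; apply: (@idl_nzd _ _ _ (lshift n k)).
    apply: (@free_of_bei _ _ _ _ _ k); last by left.
      by rewrite in_setD kC.
    rewrite inE negb_or; apply/andP; split.
      by apply: (AW (i := k)); [move: kC; rewrite inE => /andP[]|left].
    apply/imsetP => -[i + /lshift_inj ki]; by rewrite -ki !inE eqxx.
  rewrite (big_setD1 k kD) /= in hu.
  have e1 : 'X_(lshift n k) * u k = (u k * xv k + \sum_(i in D :\ k) u i * xv i)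
      - \sum_(i in D :\ k) u i * xv i by rewrite addrK mulrC.
  rewrite e1; apply: idlB.
    by apply: bei_le hu => //; exact: subsetUl.
  apply: idl_sum => i iD; apply/idlMl/bei_var.
  by rewrite inE; apply/orP; right; apply/imsetP; exists i.
set b := u k - _ in hw.
pose u' i := u i + xv k * w i.
have hu' : I A1 W e (\sum_(i in D :\ k) u' i * yv i).
  apply: (IH _ _ cD' DC').
  have -> : \sum_(i in D :\ k) u' i * xv i =
      \sum_(i in D) u i * xv i - b * xv k.
    rewrite (big_setD1 k kD) /= /b /u'.
    under eq_bigr do rewrite mulrDl -mulrA.
    by rewrite big_split /= -mulr_sumr; ring.
  by apply: idlB => //; exact: idlMr.
(* The trivial relation x_i x_k - x_k x_i becomes f i k when its second factors are changed from x
   to y, and i k is an edge because C is a clique. *)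
have -> : \sum_(i in D) u i * yv i = \sum_(i in D :\ k) u' i * yv i
    + b * yv k + \sum_(i in D :\ k) w i * f i k.
  rewrite (big_setD1 k kD) /= /b /u'.
  under [X in _ = X + _ + _]eq_bigr do rewrite mulrDl -mulrA.
  under [X in _ = _ + _ + X]eq_bigr do
    rewrite fE mulrBr [_ * (_ * yv k)]mulrA [_ * (xv k * _)]mulrCA.
  rewrite big_split /= -mulr_sumr sumrB -mulr_sumr -mulr_suml; ring.
apply: idlD; first by apply: idlD => //; apply/idlMr/I_A2_A1.
apply: idl_sum => i; rewrite inE => /andP[/[!inE] ik iD].
have iC : i \in C by exact: (subsetP DC).
by apply/idlMl/bei_edge; [exact: nbr_A1|exact: nbr_A1|exact: nbr_edge].
Qed.

(** An edge inside C contributes f i j = y_j x_i - y_i x_j, and its companion y_j y_i - y_i y_j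
    vanishes. By [nbr_closed] the other edges of A1 lie in A2, so subtracting these contributions
    leaves a relation to which [swap_xy_nbr] applies. *)
Lemma swap_xy (u : 'I_n -> S) :
  I A1 W e (\sum_(i in C) u i * xv i) -> I A1 W e (\sum_(i in C) u i * yv i).
Proof.
suff dec p : I A1 W e p -> exists w : 'I_n -> S,
    I A2 W e (p - \sum_(i in C) w i * xv i) /\
    I A1 W e (\sum_(i in C) w i * yv i).
  move=> /dec[w [hx hy]]; rewrite -sumrB in hx.
  have -> : \sum_(i in C) u i * yv i =
      \sum_(i in C) (u i - w i) * yv i + \sum_(i in C) w i * yv i.
    by rewrite -big_split; apply: eq_bigr => i _ /=; rewrite mulrBl subrK.
  apply: idlD hy; apply: swap_xy_nbr => //.
  by under eq_bigr do rewrite mulrBl.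
elim=> [|a g q hg _ [w [hx hy]]].
  by exists (fun=> 0); split; rewrite ?big1 ?subrr;
    try exact: idl0; move=> i _; rewrite mul0r.
have keep : I A2 W e g -> exists w : 'I_n -> S,
    I A2 W e (a * g + q - \sum_(i in C) w i * xv i) /\
    I A1 W e (\sum_(i in C) w i * yv i).
  move=> h; exists w; split=> //; rewrite -addrA.
  by apply: idlD hx; apply: idlMl.
case: hg => [[z zW gE]|[i [j [iA jA eij gE]]]].
  by apply: keep; rewrite gE; exact: bei_var.
have ij := nbr_closed iA jA eij.
have [iC|iC] := boolP (i \in C); last first.
  apply: keep; rewrite gE; apply: bei_edge => //.
    by rewrite inE iA iC.
  by rewrite inE jA -ij iC.
have jC : j \in C by rewrite -ij.
have delta (k : 'I_n) (c : S) (F : 'I_n -> S) : k \in C ->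
    \sum_(l in C) (if l == k then c else 0) * F l = c * F k.
  move=> kC; rewrite (bigD1 k kC) /= eqxx big1 ?addr0 //.
  move=> l /andP[_ /negbTE->].
  by rewrite mul0r.
exists (fun l => w l + (if l == i then a * yv j else 0) -
  (if l == j then a * yv i else 0)).
have sE (F : 'I_n -> S) : \sum_(l in C)
    (w l + (if l == i then a * yv j else 0) -
    (if l == j then a * yv i else 0)) * F l =
    \sum_(l in C) w l * F l + a * yv j * F i - a * yv i * F j.
  under eq_bigr do rewrite mulrBl mulrDl.
  by rewrite sumrB big_split /= !delta.
rewrite !sE gE; split; last first.
  by rewrite mulrAC -addrA subrr addr0.
have -> : a * f i j + q - (\sum_(l in C) w l * xv l + a * yv j * xv i
  - a * yv i * xv j) = q - \sum_(l in C) w l * xv l by rewrite fE; ring.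
by [].
Qed.

Lemma A1_free z : var_at v z -> forall g : S, bei_gens A1 W e g -> free_of z g.
Proof.
move=> zv; apply: (free_of_bei _ _ zv); first by rewrite !inE eqxx.
exact: AW zv.
Qed.

(* Kill x_v, use swap_xy on what remains, and divide the rest by x_v. *)
Lemma edge_syzygy (b : 'I_n -> S) :
  I A1 W e (\sum_(i in C) b i * f i v) <-> I A1 W e (\sum_(i in C) b i * xv i).
Proof.
have fsum (c : 'I_n -> S) : \sum_(i in C) c i * f i v =
    yv v * \sum_(i in C) c i * xv i - xv v * \sum_(i in C) c i * yv i.
  rewrite !mulr_sumr -sumrB; apply: eq_bigr => i _.
  by rewrite fE; ring.
have xf (c : 'I_n -> S) : I A1 W e (\sum_(i in C) c i * xv i) ->
    I A1 W e (\sum_(i in C) c i * f i v).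
  move=> h; rewrite fsum; apply: idlB; apply: idlMl => //.
  exact: swap_xy.
split; last exact: xf.
(* Division by x_v lowers the degrees of the coefficients, so a common degree bound N drives the
   induction. *)
have [N hN] : exists N, forall i u, (N <= mdeg u)%N -> (b i)@_u = 0.
  exists (\max_i msize (b i)) => i u Nu; apply/memN_msupp_eq0/msize_mdeg_ge.
  exact: leq_trans (leq_bigmax i) Nu.
elim: N b hN => [|N IH] b hN.
  move=> _; rewrite big1 => [|i _]; first exact: idl0.
  suff -> : b i = 0 by rewrite mul0r.
  by apply/mpolyP => u; rewrite mcoeff0 hN.
pose z := lshift n v; pose c i := kill z (b i); pose d i := vdiv z (b i).
have zv : var_at v z by left.
have bE (F : 'I_n -> S) : \sum_(i in C) b i * F i =
    xv v * (\sum_(i in C) d i * F i) + \sum_(i in C) c i * F i.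
  rewrite mulr_sumr -big_split; apply: eq_bigr => i _ /=.
  by rewrite mulrA -mulrDl /d /c -kill_vdiv.
have Cv i : i \in C -> i != v by rewrite inE => /and3P[].
(* Setting x_v = 0 turns f i v into y_v x_i, and y_v is a nonzerodivisor modulo I A1 W e. *)
move=> h; have hc : I A1 W e (\sum_(i in C) c i * xv i).
  apply: (idl_nzd (A1_free (or_intror erefl))).
  have [hk _] := idl_kill (A1_free zv) h; move: hk.
  rewrite kill_sum mulr_sumr.
  suff e1 i : i \in C -> kill z (b i * f i v) = yv v * (c i * xv i).
    by rewrite (eq_bigr _ e1).
  move=> iC; have [xf1 _] := free_of_var K zv (Cv i iC).
  suff [_ kf] : vdiv z (f i v) = - yv i /\ kill z (f i v) = xv i * yv v.
    by rewrite killM kf -/(c i); ring.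
  apply: vdiv_kill_uniq; first by rewrite fE /z; ring.
  by apply: free_ofM => //; apply: free_ofX; rewrite eq_sym eq_lrshift.
have hd : I A1 W e (\sum_(i in C) d i * xv i).
  apply: IH => [i u Nu|].
    by rewrite mcoeff_vdiv hN // mdegD mdeg1 addn1.
  apply: (idl_nzd (A1_free zv)).
  have := idlB h (xf _ hc).
  by rewrite bE addrK.
by rewrite bE; apply: idlD => //; apply: idlMl.
Qed.

Let W2 := W :|: [set lshift n i | i in C].

Lemma I_A1_A p : I A1 W e p -> I A W e p.
Proof. by apply: bei_le => //; exact: subsetDl. Qed.

Lemma I_A1_W2 p : I A1 W e p -> I A2 W2 e p.
Proof.
apply: idl_le => g [[z zW ->]|[i [j [iA jA eij ->]]]].
  by apply: bei_var; rewrite inE zW.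
have ij := nbr_closed iA jA eij.
have [iC|iC] := boolP (i \in C); last first.
  by apply: bei_edge => //; rewrite inE ?iA ?jA -?ij iC.
have xW k : k \in C -> I A2 W2 e (xv k).
  by move=> kC; apply: bei_var; rewrite inE imset_f ?orbT.
by rewrite fE; apply: idlB; apply: idlMr; apply: xW; rewrite -?ij.
Qed.

Lemma ext_edges p : I A W e p ->
  exists b : 'I_n -> S, I A1 W e (p - \sum_(i in C) b i * f i v).
Proof.
elim=> [|a g q hg _ [b hb]].
  exists (fun=> 0); rewrite big1 ?subr0; first exact: idl0.
  by move=> i _; rewrite mul0r.
have keep : I A1 W e g -> exists b : 'I_n -> S,
    I A1 W e (a * g + q - \sum_(i in C) b i * f i v).
  by move=> h; exists b; rewrite -addrA; apply: idlD hb; apply: idlMl.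
have add i c : i \in C -> a * g = c * f i v -> exists b : 'I_n -> S,
    I A1 W e (a * g + q - \sum_(i in C) b i * f i v).
  move=> iC ->; exists (fun j => b j + if j == i then c else 0).
  under eq_bigr do rewrite mulrDl.
  rewrite big_split /= (bigD1 i iC (F := fun j => (if _ then _ else _) * _)) /=.
  rewrite eqxx [X in _ - (_ + (_ + X))]big1 => [|j /andP[_ /negbTE->]].
    by rewrite addr0 (addrC (\sum_(_ in _) _)) opprD addrACA subrr add0r.
  by rewrite mul0r.
have ff i : f i i = 0 by rewrite fE subrr.
have I0 : I A1 W e 0 by exact: idl0.
case: hg => [[z zW gE]|[i [j [iA jA eij gE]]]].
  by apply: keep; rewrite gE; exact: bei_var.
have [iv|iv] := eqVneq i v; have [jv|jv] := eqVneq j v.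
- by apply: keep; rewrite gE iv jv ff.
- apply: (add j (- a)); first by rewrite !inE jA jv -iv eij.
  by rewrite gE iv fC mulrN mulNr.
- by apply: (add i a); rewrite ?gE ?jv // !inE iA iv -jv e_sym eij.
- by apply: keep; rewrite gE; apply: bei_edge; rewrite ?inE ?iv ?jv.
Qed.

(* By edge_syzygy, the module I A W e / I A1 W e is isomorphic, up to a shift by
   one, to I A2 W2 e / I A1 W e. *)
Lemma reg_add_vertex r :
  reg_idl (@bei_gens K n A1 W e) r.+1 -> reg_idl (@bei_gens K n A2 W2 e) r ->
  reg_idl (@bei_gens K n A W e) r.+1.
Proof.
move=> R1 R2 k.
have gA := gsub_bei K A W e; have g1 := gsub_bei K A1 W e.
have g2 := gsub_bei K A2 W2 e.
have gT := gsub_full K (n + n) (fun _ : 'I_1 => 0%N).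
have R21 : reg_upto k (fun=> 0%N) (fun v : 'rV_1 => I A2 W2 e (v 0 0))
    (fun v : 'rV_1 => I A1 W e (v 0 0)) r.+1.
  by apply: (reg_upto_sub gT g2 g1) => // u; exact: I_A1_W2.
pose MX (F : 'I_n -> S) : 'cV_n := \col_i if i \in C then F i else 0.
have MXE F (w : 'rV_n) : (w *m MX F) 0 0 = \sum_(i in C) w 0 i * F i.
  rewrite mxE [RHS]big_mkcond; apply: eq_bigr => i _ /=.
  by rewrite mxE; case: ifP => // _; rewrite mulr0.
pose Z (w : 'rV_n) := I A1 W e ((w *m MX (fun i => xv i)) 0 0).
have hX : hmx (fun=> 1%N) (fun=> 0%N) (MX (fun i => xv i)).
  move=> i j; rewrite mxE; case: ifP => _; first exact: ehomogX.
  exact: ehomog0.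
have hF : hmx (fun=> 2%N) (fun=> 0%N) (MX (fun i => f i v)).
  move=> i j; rewrite mxE; case: ifP => _; last exact: ehomog0.
  rewrite fE; apply: ehomogD; [|apply: ehomogN];
    by apply: ehomogM; exact: ehomogX.
have RT : reg_upto k (fun=> 1%N) (fun _ : 'rV_n => True) Z r.+1.
  apply: (reg_upto_preimage (gsub_full K _ _) g1 (X := MX (fun i => xv i))) R21.
  split=> // [w _|p hp].
    rewrite MXE; apply: idl_sum => i iC; apply/idlMl/bei_var.
    by rewrite inE imset_f ?orbT.
  have hp1 : I A1 W2 e (p 0 0) by apply: bei_le hp => //; exact: subsetDl.
  have [b hb] := ext_vars hp1; exists (\row_i b i) => //.
  rewrite mxE [X in _ + X]mxE MXE.
  by under eq_bigr do rewrite mxE.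
(* The f_iv have degree 2, the x_i degree 1: the shift raises the bound to r + 2, and the quotient
   rule brings it back to r + 1. *)
have RT2 := reg_upto_shift RT.
have RA : reg_upto k (fun=> 0%N) (fun v : 'rV_1 => I A W e (v 0 0))
    (fun v : 'rV_1 => I A1 W e (v 0 0)) r.+2.
  apply: (reg_upto_image (gsub_full K _ _) g1
    (X := MX (fun i => f i v))) RT2 => //.
  split=> // [w _|w _|p hp].
  - rewrite MXE; apply: idl_sum => i; rewrite inE => /and3P[iA vi _].
    by apply/idlMl/bei_edge; rewrite // e_sym.
  - by rewrite /Z !MXE; split=> /edge_syzygy.
  - have [b hb] := ext_edges hp; exists (\row_i b i) => //.
    rewrite mxE [X in _ + X]mxE MXE.
    by under eq_bigr do rewrite mxE.
by apply: (reg_upto_quot gT gA g1) RA => // u; exact: I_A1_A.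
Qed.

End OneVertex.

Lemma reg_cliques r (A : {set 'I_n}) W (e : rel 'I_n) (D : {set {set 'I_n}}) :
  ssrbool.symmetric e -> trans_on A e -> off_vars A W ->
  (forall i, i \in A -> exists2 B, B \in D & i \in B) ->
  (forall B, B \in D -> clique e B) -> (#|D| <= r)%N ->
  reg_idl (@bei_gens K n A W e) r.
Proof.
move=> e_sym; move: {2}#|A|.+1 (ltnSn #|A|) => N.
elim: N A W D r => [//|N IH] A W D r AN tr AW cov cl Dr.
have [->|[v vA]] := set_0Vmem A.
  by move=> k; apply: reg_upto_mono (reg_bei_vars K e W k).
have [B BD vB] := cov _ vA.
have Dr' : (#|D :\ B| < r)%N by apply: leq_trans Dr; rewrite (cardsD1 B D) BD.
case: r Dr Dr' => // r Dr Dr'.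
have AvN : (#|A :\ v| < N)%N by move: AN; rewrite (cardsD1 v) vA.
apply: (reg_add_vertex e_sym tr AW vA).
  apply: (IH _ _ D) => // [i j k|i z|i].
  - by rewrite !inE => /andP[_ ?] /andP[_ ?] /andP[_ ?]; apply: tr.
  - by rewrite inE => /andP[_]; apply: AW.
  - by rewrite inE => /andP[_]; apply: cov.
apply: (IH _ _ (D :\ B)) => // [|i j k|i z|i|B'].
- by apply: leq_ltn_trans AvN; apply: subset_leq_card; exact: subsetDl.
- rewrite !inE => /and3P[_ _ ?] /and3P[_ _ ?] /and3P[_ _ ?].
  exact: tr.
- rewrite !inE => /and3P[iC iv iA] zi; rewrite negb_or (AW _ _ iA zi) /=.
  apply/imsetP => -[j jC]; case: zi => ->.
    by move/lshift_inj => ij; move: iC; rewrite iA iv ij andbT; move: jC;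
      rewrite inE => /and3P[_ ->].
  by move/eqP; rewrite eq_sym eq_lrshift.
- rewrite !inE => /and3P[iC iv iA]; have [B' BD' iB'] := cov _ iA.
  exists B' => //; rewrite !inE BD' andbT; apply: contraNneq iC => BB.
  rewrite iA iv andbT; rewrite BB in iB'.
  have /forall_inP/(_ v vB)/forall_inP/(_ i iB')/implyP := cl _ BD.
  by apply; rewrite eq_sym.
- by rewrite inE => /andP[_]; apply: cl.
Qed.

End DisjointCliques.

(** * Completing the neighbourhood of a vertex *)

Definition complete_nbrs (T : eqType) (e : rel T) (v : T) : rel T :=
  fun i j => e i j || [&& e v i, e v j & i != j].

Section Ohtani.

Variables (K : fieldType) (n : nat).
Local Notation S := {mpoly K[n + n]}.
Local Notation xv i := ('X_(lshift n i) : S).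
Local Notation yv i := ('X_(rshift n i) : S).
Local Notation f i j := (edge_binomial K i j).
Local Notation I A W e := (idl (@bei_gens K n A W e)).

Variables (A : {set 'I_n}) (W : {set 'I_(n + n)}) (e : rel 'I_n) (v : 'I_n).
Hypotheses (e_irr : irreflexive e) (vA : v \in A).

Let ev := complete_nbrs e v.
Let A' := A :\ v.
Let W' := W :|: [set lshift n v; rshift n v].

Definition kill_vertex (p : S) : S := kill (rshift n v) (kill (lshift n v) p).

Lemma kill_var z w : kill z ('X_w : S) = if w == z then 0 else 'X_w.
Proof.
case: eqVneq => [->|wz]; first by have := killX z (1 : S); rewrite mulr1.
by rewrite kill_free //; exact: free_ofX.
Qed.

Lemma kill_vertex0 : kill_vertex 0 = 0.
Proof. by rewrite /kill_vertex !kill0. Qed.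

Lemma kill_vertexD p q : kill_vertex (p + q) = kill_vertex p + kill_vertex q.
Proof. by rewrite /kill_vertex !killD. Qed.

Lemma kill_vertexM p q : kill_vertex (p * q) = kill_vertex p * kill_vertex q.
Proof. by rewrite /kill_vertex !killM. Qed.

Lemma kill_vertexX z : kill_vertex 'X_z =
  if (z == lshift n v) || (z == rshift n v) then 0 else 'X_z.
Proof.
rewrite /kill_vertex kill_var; case: eqP => _ /=; first by rewrite kill0.
by rewrite kill_var.
Qed.

Lemma kill_vertex_edge i j : kill_vertex (f i j) =
  if (i == v) || (j == v) then 0 else f i j.
Proof.
have [/orP[]/eqP->|] := ifP.
- have -> : f v j = xv v * yv j + (- xv j) * yv v by rewrite fE; ring.
  rewrite kill_vertexD !kill_vertexM !kill_vertexX !eqxx orbT.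
  by rewrite mul0r mulr0 addr0.
- have -> : f i v = xv i * yv v + (- yv i) * xv v by rewrite fE; ring.
  rewrite kill_vertexD !kill_vertexM !kill_vertexX !eqxx orbT.
  by rewrite !mulr0 addr0.
move/negbT; rewrite negb_or => /andP[iv jv].
have fl : free_of (lshift n v) (f i j).
  exact: (free_of_edge (or_introl erefl)).
have fr : free_of (rshift n v) (f i j).
  exact: (free_of_edge (or_intror erefl)).
by rewrite /kill_vertex (kill_free fl) kill_free.
Qed.

Lemma kill_vertex_L p : I A W' e p -> I A W e (kill_vertex p).
Proof.
elim=> [|a g q hg _ IH]; first by rewrite kill_vertex0; exact: idl0.
rewrite kill_vertexD kill_vertexM; apply: idlD IH; apply: idlMl.
case: hg => [[z + ->]|[i [j [iA jA eij ->]]]]; last first.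
  by rewrite kill_vertex_edge; case: ifP => _; [exact: idl0|exact: bei_edge].
rewrite kill_vertexX !inE; case: ifP => [_ _|_]; first exact: idl0.
by rewrite orbF; exact: bei_var.
Qed.

Lemma sub_kill_vertex a :
  exists b c, a - kill_vertex a = xv v * b + yv v * c.
Proof.
exists (vdiv (lshift n v) a), (vdiv (rshift n v) (kill (lshift n v) a)).
by rewrite /kill_vertex /kill; ring.
Qed.

(** For a new edge, a * f_ij changes by (a - kill_vertex a) * f_ij, whose first factor lies in (x_v,
    y_v); both variables multiply f_ij into I A W e. *)
Lemma sub_kill_L p : I A W ev p -> I A W e (p - kill_vertex p).
Proof.
elim=> [|a g q hg _ IH]; first by rewrite kill_vertex0 subrr; exact: idl0.
rewrite kill_vertexD kill_vertexM opprD addrACA; apply: idlD IH.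
have old : I A W e g -> I A W e (a * g - kill_vertex a * kill_vertex g).
  move=> h; apply: idlB; apply: idlMl => //; apply: kill_vertex_L.
  by apply: bei_le h => //; exact: subsetUl.
case: hg => [[z zW gE]|[i [j [iA jA + gE]]]].
  by apply: old; rewrite gE; exact: bei_var.
case/orP=> [eij|/and3P[vi vj ij]].
  by apply: old; rewrite gE; exact: bei_edge.
have ne k : e v k -> k != v by apply: contraTneq => ->; rewrite e_irr.
rewrite gE kill_vertex_edge (negbTE (ne _ vi)) (negbTE (ne _ vj)) /=.
have [b [c bc]] := sub_kill_vertex a.
have -> : a * f i j - kill_vertex a * f i j =
    b * (xv i * f v j - xv j * f v i) + c * (yv i * f v j - yv j * f v i).
  by rewrite -mulrBl bc !fE; ring.
have fi : I A W e (f v i) by exact: bei_edge.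
have fj : I A W e (f v j) by exact: bei_edge.
by apply: idlD; apply: idlMl; apply: idlB; apply: idlMl.
Qed.

Lemma ohtani p : I A W ev p -> I A' W' e p -> I A W e p.
Proof.
move=> /sub_kill_L h1 h2; rewrite -(subrK (kill_vertex p) p); apply: idlD h1 _.
by apply: kill_vertex_L; apply: bei_le h2 => //; exact: subsetDl.
Qed.

(** Write L, L1, L2, L3 for the ideals of G, G_v, G - v and G_v - v, the last two with x_v, y_v
    added. As L is the intersection of L1 and L2 and L3 is their sum, L1 / L is isomorphic to L3 /
    L2. The submodule rule bounds L3 / L2 by r + 1, and S / L is an extension of S / L1 by L1 /
    L. *)
Lemma reg_ohtani r :
  reg_idl (@bei_gens K n A W ev) r.+1 -> reg_idl (@bei_gens K n A' W' e) r.+1 ->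
  reg_idl (@bei_gens K n A' W' ev) r -> reg_idl (@bei_gens K n A W e) r.+1.
Proof.
move=> R1 R2 R3 k.
have g := gsub_bei K A W e; have g1 := gsub_bei K A W ev.
have g2 := gsub_bei K A' W' e; have g3 := gsub_bei K A' W' ev.
have gT := gsub_full K (n + n) (fun _ : 'I_1 => 0%N).
have e_ev : subrel e ev by move=> i j; rewrite /ev /complete_nbrs => ->.
have W_W' : W \subset W' by exact: subsetUl.
have LL1 p : I A W e p -> I A W ev p by exact: bei_le.
have L23 p : I A' W' e p -> I A' W' ev p by exact: bei_le.
have inW' z : z = lshift n v \/ z = rshift n v -> z \in W'.
  by case=> ->; rewrite !inE eqxx ?orbT.
have edge2 (e' : rel 'I_n) i j : i \in A -> j \in A -> e' i j ->
    I A' W' e' (f i j).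
  move=> iA jA eij; have xW : I A' W' e' (xv v) by apply/bei_var/inW'; left.
  have yW : I A' W' e' (yv v) by apply/bei_var/inW'; right.
  have [->|iv] := eqVneq i v.
    by rewrite fE; apply: idlB; [exact: idlMr|exact: idlMl].
  have [->|jv] := eqVneq j v.
    by rewrite fE; apply: idlB; [exact: idlMl|exact: idlMr].
  by apply: bei_edge; rewrite // !inE ?iv ?jv.
have sub2 e' p : I A W e' p -> I A' W' e' p.
  apply: idl_le => h [[z zW ->]|[i [j [iA jA eij ->]]]]; last exact: edge2.
  exact/bei_var/(subsetP W_W').
apply: (reg_upto_ext gT g1 g) => // [u|]; first exact: LL1.
have R32 : reg_upto k (fun=> 0%N) (fun u : 'rV_1 => I A' W' ev (u 0 0))
    (fun u : 'rV_1 => I A' W' e (u 0 0)) r.+1.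
  by apply: (reg_upto_sub gT g3 g2) => // u; exact: L23.
apply: (reg_upto_preimage g1 g2 (X := 1%:M)) R32.
split=> [|u|u hu|u hu]; rewrite ?mulmx1.
- exact: hmx1.
- exact: sub2.
- by split=> [|h]; [exact: sub2|exact: ohtani].
- suff [p hp hup] : exists2 p, I A W ev p & I A' W' e (u 0 0 - p).
    by exists p%:M; rewrite ?mulmx1 mxE ?[X in _ + X]mxE ?[p%:M _ _]mxE ?eqxx.
  elim: hu => [|a h q hh _ [p hp hup]].
    by exists 0; rewrite ?subrr; exact: idl0.
  case: hh => [[z zW ->]|[i [j [iA jA eij ->]]]].
    exists p => //; rewrite -addrA; apply: idlD hup.
    exact/idlMl/bei_var.
  exists (a * f i j + p).
    apply: idlD hp; apply: idlMl; move: iA jA; rewrite !inE.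
    by move=> /andP[_ iA] /andP[_ jA]; exact: bei_edge.
  by rewrite opprD addrACA subrr add0r.
Qed.

End Ohtani.

(** * Chordal graphs *)

Section Chordal.

Variable n : nat.
Implicit Types (e : rel 'I_n) (A B C : {set 'I_n}).

(** A path from a to b in this graph closes through v to a cycle on which v has no neighbours
    besides a and b. *)
Definition avoiding e v a b : rel 'I_n :=
  let R := [pred x | (x == a) || (x == b) || ((x != v) && ~~ e v x)] in
  [rel x y | [&& R x, R y & e x y]].

Lemma avoidingE e v a b x y : avoiding e v a b x y =
  [&& (x == a) || (x == b) || ((x != v) && ~~ e v x),
      (y == a) || (y == b) || ((y != v) && ~~ e v y) & e x y].
Proof. by []. Qed.

(* Equivalent to chordality, but stable under completing a neighbourhood
   without having to handle cycles. *)
Definition separated e := forall v a b, e v a -> e v b -> a != b ->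
  connect (avoiding e v a b) a b -> e a b.

Lemma avoidingC e v a b : avoiding e v a b =2 avoiding e v b a.
Proof. by move=> x y; rewrite !avoidingE (orbC (x == a)) (orbC (y == a)). Qed.

Lemma connect_avoidingC e v a b : ssrbool.symmetric e ->
  connect (avoiding e v a b) a b -> connect (avoiding e v b a) b a.
Proof.
move=> e_sym; rewrite (eq_connect (avoidingC e v b a)) sym_connect_sym //.
by move=> x y; rewrite !avoidingE (e_sym x y) andbCA.
Qed.

Lemma separated_C4 e v a b w : separated e -> e v a -> e v b -> a != b ->
  w != v -> ~~ e v w -> e a w -> e w b -> e a b.
Proof.
move=> sep va vb ab wv vw aw wb; apply: (sep v) => //.
apply: (@connect_trans _ _ w); apply: connect1.
  by rewrite avoidingE eqxx wv vw aw !orbT.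
by rewrite avoidingE eqxx wv vw wb !orbT.
Qed.

Lemma complete_nbrs_simple e v :
  simple_graph e -> simple_graph (complete_nbrs e v).
Proof.
move=> [e_sym e_irr]; split=> [i j|i]; rewrite /complete_nbrs.
  by rewrite e_sym andbCA (eq_sym i).
by rewrite e_irr eqxx !andbF.
Qed.

(** If v is outside the closed neighbourhood of w, it keeps its neighbours, and each new edge on a
    path can be replaced by a detour through w. Otherwise all neighbours of w other than v become
    adjacent to v, so the only new edge that a path can use is a b itself. *)
Lemma separated_complete_nbrs e w : simple_graph e -> separated e ->
  separated (complete_nbrs e w).
Proof.
move=> [e_sym e_irr] sep v a b; set e' := complete_nbrs e w.
have [e'_sym _] : simple_graph e' by exact: complete_nbrs_simple.
have ee' x y : e x y -> e' x y by rewrite /e' /complete_nbrs => ->.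
have [wv|wv] := boolP ((v == w) || e w v); last first.
  move: wv; rewrite negb_or => /andP[vw wv].
  have E x : e' v x = e v x by rewrite /e' /complete_nbrs (negbTE wv) orbF.
  rewrite !E => va vb ab h; apply/ee'/(sep v) => //.
  apply: connect_sub h => x y; rewrite avoidingE !E => /and3P[xR yR].
  case/orP=> [xy|/and3P[wx wy xy]].
    by apply: connect1; rewrite avoidingE xR yR.
  have wR : ((w == a) || (w == b)) || (w != v) && ~~ e v w.
    by rewrite (eq_sym w v) vw (e_sym v) wv !orbT.
  apply: (@connect_trans _ _ w); apply: connect1;
    rewrite avoidingE wR ?xR ?yR //.
  by rewrite e_sym.
have Nw x : e w x || (x == w) -> x != v -> e' v x.
  move=> wx xv; rewrite /e' /complete_nbrs.
  case/orP: wv xv => [/eqP-> xw|wv xv].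
    by move: wx; rewrite (negbTE xw) orbF => ->.
  case/orP: wx => [wx|/eqP->]; last by rewrite e_sym wv.
  by rewrite wv wx eq_sym xv orbT.
have conn x y : ~~ e' x y -> connect (avoiding e' v x y) x y ->
    connect (avoiding e v x y) x y.
  move=> nxy; apply: connect_sub => s t; rewrite avoidingE => /and3P[sR tR st].
  have sub z : [|| z == x, z == y | (z != v) && ~~ e' v z] ->
      [|| z == x, z == y | (z != v) && ~~ e v z].
    case/or3P=> [->//|->|/andP[-> vz]]; rewrite ?orbT //.
    by rewrite (contraNN (ee' v z) vz) !orbT.
  apply: connect1; rewrite avoidingE -!orbA; apply/and3P; split.
  - by apply: sub; rewrite orbA.
  - by apply: sub; rewrite orbA.
  case/orP: st => // /and3P[ws wt st].
  have out z : e w z -> [|| z == x, z == y | (z != v) && ~~ e' v z] ->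
      (z == x) || (z == y).
    move=> wz; rewrite orbA => /orP[//|/andP[zv]].
    by rewrite Nw ?wz.
  have := out _ ws; rewrite orbA sR => /(_ isT) /orP[]/eqP sx;
  have := out _ wt; rewrite orbA tR => /(_ isT) /orP[]/eqP tx;
    move: nxy st; rewrite ?sx ?tx ?eqxx //.
  - by move=> + xy; rewrite /e' /complete_nbrs -sx -tx ws wt sx tx xy orbT.
  - move=> + xy; rewrite /e' /complete_nbrs -sx -tx ws wt sx tx eq_sym xy.
    by rewrite orbT.
(* If v x were new, w x would be an edge and w y would not, as x y would then be added. Now x is a
   non-neighbour of v in e, so prepending w to the path and applying [sep] at v gives the edge w
   y. *)
have adj x y : e' v x -> e' v y -> x != y -> ~~ e' x y ->
    connect (avoiding e v x y) x y -> e v x.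
  move=> /orP[//|/and3P[wv' wx vx]] vy xy nxy h; apply: contraT => nvx.
  have wy : ~~ e w y.
    by apply: contra nxy => wy; rewrite /e' /complete_nbrs wx wy xy orbT.
  have vy' : e v y by case/orP: vy => // /and3P[_ wy' _]; rewrite wy' in wy.
  have wny : w != y.
    by apply: contra nxy => /eqP <-; rewrite ee' // e_sym.
  case/negP: wy; apply: (sep v) => //; first by rewrite e_sym.
  apply: (@connect_trans _ _ x).
    by apply: connect1; rewrite avoidingE eqxx (eq_sym x v) vx nvx wx !orbT.
  apply: connect_sub h => s t; rewrite avoidingE => /and3P[sR tR st].
  apply: connect1.
  have sub z : ((z == x) || (z == y)) || (z != v) && ~~ e v z ->
      ((z == w) || (z == y)) || (z != v) && ~~ e v z.
    case/orP=> [/orP[/eqP->|->]|->]; rewrite ?orbT //.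
    by rewrite (eq_sym x v) vx nvx !orbT.
  by rewrite avoidingE !sub.
move=> va vb ab h; apply: contraT => nab; have h1 := conn _ _ nab h.
case/negP: (nab); apply/ee'/(sep v) => //; first exact: (adj a b).
have nba : ~~ e' b a by rewrite e'_sym.
by apply: (adj b a) => //; [rewrite eq_sym|exact: connect_avoidingC].
Qed.

Definition clique_in A e : pred {set 'I_n} :=
  fun B => (B \subset A) && clique e B.

Definition max_cliques A e := [set B | maxset (clique_in A e) B].

Lemma cliqueP e B : reflect (forall i j, i \in B -> j \in B -> i != j -> e i j)
  (clique e B).
Proof.
apply: (iffP forall_inP) => [h i j iB jB|h i iB].
  by move/forall_inP: (h i iB) => /(_ j jB)/implyP.
by apply/forall_inP => j jB; apply/implyP; exact: h.
Qed.

Lemma num_max_cliquesE e : num_max_cliques e = #|max_cliques setT e|.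
Proof.
congr #|pred_of_set _|; apply/setP => B; rewrite !inE.
by apply: maxset_eq => C; rewrite /clique_in subsetT.
Qed.

Lemma max_clique_exists A e B : clique_in A e B ->
  exists2 C, C \in max_cliques A e & B \subset C.
Proof.
by case/maxset_exists=> C mC BC; exists C; rewrite // inE.
Qed.

(** Each maximal clique of A is the trace on A of a maximal clique of A' containing it. *)
Lemma max_cliques_mono A A' e : A \subset A' ->
  (#|max_cliques A e| <= #|max_cliques A' e|)%N.
Proof.
move=> AA'; apply: leq_trans (leq_imset_card (fun C => C :&: A) _).
apply/subset_leq_card/subsetP => B; rewrite inE => /maxsetP[/andP[BA cB] mB].
have [C mC BC] : exists2 C, C \in max_cliques A' e & B \subset C.
  by apply: max_clique_exists; rewrite /clique_in (subset_trans BA).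
apply/imsetP; exists C => //; apply/esym/mB; last by rewrite subsetI BC.
rewrite /clique_in subsetIr; move: mC.
rewrite inE => /maxsetP[/andP[_ /cliqueP cC] _].
by apply/cliqueP => i j; rewrite !inE => /andP[iC _] /andP[jC _]; exact: cC.
Qed.

(* The maximal cliques after completing the neighbourhood of v are N[v] and
   maximal cliques of e avoiding v. *)
Lemma max_cliques_complete A e v a b : simple_graph e -> separated e ->
  v \in A -> a \in A -> b \in A -> e v a -> e v b -> a != b -> ~~ e a b ->
  (#|max_cliques A (complete_nbrs e v)| < #|max_cliques A e|)%N.
Proof.
move=> [e_sym e_irr] sep vA aA bA va vb ab nab.
set e' := complete_nbrs e v.
have ee' x y : e x y -> e' x y by rewrite /e' /complete_nbrs => ->.
have e'v x : e' v x = e v x by rewrite /e' /complete_nbrs e_irr orbF.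
have [e'_sym _] : simple_graph e' by exact: complete_nbrs_simple.
have nv x : e v x -> v != x by apply: contraTneq => <-; rewrite e_irr.
pose N := [set x in A | (x == v) || e v x].
have cN : clique_in A e' N.
  apply/andP; split; first by apply/subsetP => x; rewrite inE => /andP[].
  apply/cliqueP => x y; rewrite !inE => /andP[_ xN] /andP[_ yN] xy.
  case/orP: xN xy => [/eqP->|vx] xy; case/orP: yN xy => [/eqP->|vy] xy.
  - by rewrite eqxx in xy.
  - exact: ee'.
  - by apply: ee'; rewrite e_sym.
  - by rewrite /e' /complete_nbrs vx vy xy orbT.
have edge_clique x : x \in A -> e v x ->
    exists2 C, C \in max_cliques A e & [set v; x] \subset C.
  move=> xA vx; apply: max_clique_exists; apply/andP; split.
    by rewrite subUset !sub1set vA.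
  apply/cliqueP => i j; rewrite !inE => /orP[]/eqP-> /orP[]/eqP->.
  - by rewrite eqxx.
  - by [].
  - by rewrite e_sym.
  - by rewrite eqxx.
have [C1 mC1] := edge_clique a aA va.
rewrite subUset !sub1set => /andP[vC1 aC1].
have [C2 mC2] := edge_clique b bA vb.
rewrite subUset !sub1set => /andP[vC2 bC2].
have C12 : C2 != C1.
  apply: contra nab => /eqP C12; move: mC1.
  rewrite inE => /maxsetP[/andP[_ /cliqueP cC1] _].
  by apply: cC1; rewrite // -C12.
(* C1 and C2 both contain v and disappear, while at most N is new; this is the strict drop. *)
have sub : max_cliques A e' \subset N |: (max_cliques A e :\ C1 :\ C2).
  apply/subsetP => B; rewrite inE => /maxsetP[/andP[BA /cliqueP cB] maxB].
  rewrite in_setU1; have [//|BN] := eqVneq B N; rewrite /=.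
  have vB : v \notin B.
    apply: contra BN => vB; apply/eqP/esym/maxB => //.
    apply/subsetP => x xB; rewrite inE (subsetP BA) //=.
    by have [//|xv] := eqVneq x v; rewrite -e'v cB // eq_sym.
  rewrite !in_setD1 inE (contraNneq _ vB) => [|->//].
  rewrite (contraNneq _ vB) => [/=|->//].
  (* A new edge i j of B would give the 4-cycle v i w j without the diagonal v w, so [separated_C4]
     shows that i j is already an edge of e. *)
  have [w wB wN] : exists2 w, w \in B & w \notin N.
    apply/subsetPn; apply: contra vB => BN'.
    by rewrite -(maxB _ cN BN') inE vA eqxx.
  have [wv vw] : w != v /\ ~~ e v w.
    by move: wN; rewrite inE (subsetP BA) //= negb_or => /andP.
  have wadj i : i \in B -> e v i -> e i w.
    move=> iB vi; have iw : i != w by apply: contraNneq vw => <-.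
    have := cB _ _ iB wB iw; rewrite /e' /complete_nbrs.
    by rewrite (negbTE vw) andbF orbF.
  apply/maxsetP; split.
    rewrite /clique_in BA; apply/cliqueP => i j iB jB ij.
    have /orP[//|/and3P[vi vj _]] := cB _ _ iB jB ij.
    apply: (separated_C4 sep vi vj ij wv vw); first exact: wadj.
    by rewrite e_sym; exact: wadj.
  move=> C /andP[CA /cliqueP cC] BC; apply: maxB => //.
  rewrite /clique_in CA; apply/cliqueP => i j iC jC ij.
  exact/ee'/cC.
have := subset_leq_card sub; rewrite cardsU1.
rewrite [#|max_cliques A e|](cardsD1 C1) mC1 [#|_ :\ C1|](cardsD1 C2).
rewrite [C2 \in _]in_setD1 C12 mC2 /= => h.
apply: leq_ltn_trans h _; rewrite add1n ltnS leq_add2r; exact: leq_b1.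
Qed.

Lemma path_avoiding e v a b x p : path (avoiding e v a b) x p ->
  path e x p /\
  {in p, forall y, ((y == a) || (y == b)) || ((y != v) && ~~ e v y)}.
Proof.
elim: p x => [//|y p IH] x /=; rewrite avoidingE.
move=> /andP[/and3P[_ yR xy] /IH[yp pR]]; split; first by rewrite xy.
by move=> z; rewrite inE => /orP[/eqP->//|]; exact: pR.
Qed.

(** A chord from index i to an index beyond i + 1 shortcuts the path without moving its ends;
    induction on the length removes all chords. *)
Lemma chordless_path (r : rel 'I_n) x p : path r x p -> uniq (x :: p) ->
  exists q, [/\ path r x q, uniq (x :: q), last x q = last x p &
    forall i j, (i < j < (size q).+1)%N ->
      r (nth x (x :: q) i) (nth x (x :: q) j) -> j = i.+1].
Proof.
move: {2}(size p).+1 (ltnSn (size p)) => N; elim: N p => [//|N IH] p pN rp up.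
have [ok|] := boolP [forall i : 'I_(size p).+1, forall j : 'I_(size p).+1,
  ((i < j)%N && r (nth x (x :: p) i) (nth x (x :: p) j)) ==>
  (j == i.+1 :> nat)].
  exists p; split=> // i j /andP[ij jp] rij.
  move/forallP: ok => /(_ (Ordinal (ltn_trans ij jp)))/forallP/(_ (Ordinal jp)).
  by rewrite /= ij rij => /eqP.
rewrite negb_forall => /existsP[[i ip]].
rewrite negb_forall => /existsP[[j jp]].
rewrite negb_imply /= => /andP[/andP[ij rij] jNi].
have {}ij : (i.+1 < j)%N by rewrite ltn_neqAle eq_sym jNi ij.
case: j jp ij rij jNi => // j jp ij rij _; rewrite ltnS in ij jp.
have pE : p = take j p ++ nth x p j :: drop j.+1 p.
  by rewrite -drop_nth // cat_take_drop.
(* Here j is an index in p and i one in x :: p: [take i p] ends at the start of the chord, and nth x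
   p j is its other end. *)
pose q := take i p ++ nth x p j :: drop j.+1 p.
have qp : subseq q p.
  rewrite {1}pE cat_subseq //.
  have -> : take i p = take i (take j p).
    by rewrite -take_min (minn_idPl (ltnW ij)).
  exact: take_subseq.
have lastq : last x q = last x p by rewrite {1}pE !last_cat.
have rq : path r x q.
  have := rp; rewrite {1}pE /q !cat_path /= => /and3P[_ _ ->].
  rewrite take_path //= andbT.
  suff -> : last x (take i p) = nth x (x :: p) i by [].
  case: i ip {ij rij q qp lastq} => [|i] ip; first by rewrite take0.
  by rewrite (last_nth x) size_takel //= nth_take.
have uq : uniq (x :: q).
  by apply: subseq_uniq up => /=; rewrite eqxx.
have qN : (size q < N)%N.
  rewrite ltnS in pN; apply: leq_trans pN.
  rewrite {1}pE !size_cat ltn_add2r !size_takel //; exact: ltnW.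
have [q' [h1 h2 h3 h4]] := IH _ qN rq uq.
by exists q'; rewrite h3.
Qed.

(** A chordless path from a to b closes through v to an induced cycle, which has at least four
    vertices unless a b is an edge. *)
Lemma chordal_separated e : simple_graph e -> chordal e -> separated e.
Proof.
move=> [e_sym e_irr] ch v a b va vb ab /connectP[p0 rp0].
case/shortenP: rp0 => p1 rp1 up1 _ lp1.
have [p [rp up lp short]] := chordless_path rp1 up1; rewrite -lp1 in lp.
have [ep pR] := path_avoiding rp.
apply: contraT => nab.
have vs : v \notin a :: p.
  apply/negP; rewrite inE => /orP[/eqP av|/pR]; first by rewrite av e_irr in va.
  rewrite eqxx /= orbF => /orP[]/eqP av; first by rewrite av e_irr in va.
  by rewrite av e_irr in vb.
pose c := v :: a :: p.
have uc : uniq c by rewrite cons_uniq vs.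
have nbr_v y : y \in a :: p -> e v y -> (y == a) || (y == b).
  rewrite inE => /orP[/eqP->|/pR]; first by rewrite eqxx.
  by move=> + vy; rewrite vy andbF orbF.
have step i j : (i < j < size c)%N -> e (nth v c i) (nth v c j) ->
    (nth v c j == next c (nth v c i)) || (nth v c j == prev c (nth v c i)).
  move=> /andP[ij jc] eij; have ic := ltn_trans ij jc.
  have next_c k : (k < size c)%N -> next c (nth v c k) = nth v (a :: p) k.
    move=> kc; rewrite -[k in RHS](index_uniq v kc uc).
    by rewrite next_nth mem_nth.
  rewrite next_c //.
  case: i j ij jc ic eij => [|i] [|j] // ij jc ic eij.
    have jp : nth v (a :: p) j \in a :: p by exact: mem_nth.
    have /orP[/eqP ja|/eqP jb] := nbr_v _ jp eij; first by rewrite /= ja eqxx.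
    suff prev_v : prev c v = b.
      by rewrite -[nth v c 0]/v prev_v [nth v c _]jb eqxx orbT.
    rewrite prev_nth mem_head -[LHS]/(nth v c (index v (a :: p))) memNindex //.
    by rewrite -(last_nth v) -lp.
  rewrite /= in eij ic jc *.
  have -> : j = i.+1.
    apply: short; first by rewrite ltnS in ij; rewrite ij.
    rewrite !(set_nth_default v a) // avoidingE.
    have sR y : y \in a :: p -> (y == a) || (y == b) || (y != v) && ~~ e v y.
      by rewrite inE => /orP[/eqP->|/pR //]; rewrite eqxx.
    by rewrite !sR ?mem_nth.
  by rewrite eqxx.
have : induced_cycle e c.
  rewrite /induced_cycle /ucycleb uc andbT; apply/andP; split.
    by rewrite /= rcons_path va ep lp e_sym.
  apply/forall_inP => x xc; apply/forall_inP => y yc; apply/implyP => xy.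
  have [ltxy|ltyx|ixy] := ssrnat.ltngtP (index x c) (index y c).
  - have := @step (index x c) (index y c); rewrite ltxy index_mem yc.
    by rewrite !nth_index // => /(_ isT xy).
  - have := @step (index y c) (index x c); rewrite ltyx index_mem xc.
    rewrite !nth_index // e_sym => /(_ isT xy) /orP[]/eqP->.
      by rewrite prev_next // eqxx orbT.
    by rewrite next_prev // eqxx.
  - by move: xy; rewrite -(nth_index v xc) -(nth_index v yc) ixy e_irr.
move/ch; rewrite /c.
case: p {rp up short pR vs c uc nbr_v step} lp ep => [|y [|z q]] //=.
  by move=> ab'; rewrite ab' eqxx in ab.
by move=> ->; rewrite (negbTE nab).
Qed.

End Chordal.

(** * Induction over chordal graphs *)

Section Main.

Variables (K : fieldType) (n : nat).
Implicit Types (e : rel 'I_n) (A : {set 'I_n}).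

Definition non_edges e := [set p | (p.1 != p.2) && ~~ e p.1 p.2].

Lemma reg_idl_mono m (G : {mpoly K[m]} -> Prop) r s :
  (r <= s)%N -> reg_idl G r -> reg_idl G s.
Proof. by move=> rs R k; apply: reg_upto_mono (R k). Qed.

Lemma off_vars_setD1 A W v :
  off_vars A W -> off_vars (A :\ v) (W :|: [set lshift n v; rshift n v]).
Proof.
move=> AW i z; rewrite !inE => /andP[iv iA] zi.
rewrite negb_or (AW _ _ iA zi) /=.
case: zi => ->; rewrite ?eq_lrshift.
  by rewrite (inj_eq (@lshift_inj _ _)) (negbTE iv).
by rewrite (inj_eq (@rshift_inj _ _)) (negbTE iv) orbF eq_sym eq_lrshift.
Qed.

(** The measure falls in all three recursive calls: completion at v adds the edge a b, and deletion
    of v shrinks A. When no completion applies, e is transitive on A, and its maximal cliques form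
    the cover required by [reg_cliques]. *)
Lemma reg_chordal e A W : simple_graph e -> separated e -> off_vars A W ->
  reg_idl (@bei_gens K n A W e) #|max_cliques A e|.
Proof.
move: {2}(#|A| + #|non_edges e|).+1 (ltnSn (#|A| + #|non_edges e|)) => N.
elim: N e A W => [//|N IH] e A W leN simp sep AW.
have [e_sym e_irr] := simp.
have [|tr] := boolP [exists v in A, exists a in A, exists b in A,
    [&& e v a, e v b, a != b & ~~ e a b]].
  case/exists_inP=> v vA /exists_inP[a aA /exists_inP[b bA]].
  case/and4P=> va vb ab nab.
  have lt := max_cliques_complete simp sep vA aA bA va vb ab nab.
  case E : #|max_cliques A e| lt => [//|r] lt.
  have sA : A :\ v \subset A by exact: subsetDl.
  have cA : (#|A :\ v| < #|A|)%N by rewrite [#|A|](cardsD1 v) vA.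
  have cE : (#|non_edges (complete_nbrs e v)| < #|non_edges e|)%N.
    apply/proper_card/properP; split.
      apply/subsetP => p; rewrite !inE negb_or => /and3P[-> -> _] //.
    by exists (a, b); rewrite !inE /= ?ab ?nab //= /complete_nbrs va vb ab orbT.
  have simp' := complete_nbrs_simple v simp.
  have sep' := separated_complete_nbrs (w := v) simp sep.
  apply: (reg_ohtani e_irr vA).
  - apply: reg_idl_mono (IH _ _ _ _ simp' sep' AW); first exact: ltnW.
    by rewrite -ltnS; apply: leq_trans leN; rewrite ltnS ltn_add2l.
  - apply: reg_idl_mono (IH _ _ _ _ simp sep (off_vars_setD1 AW)).
      by rewrite -E; exact: max_cliques_mono.
    by rewrite -ltnS; apply: leq_trans leN; rewrite ltnS ltn_add2r.
  - apply: reg_idl_mono (IH _ _ _ _ simp' sep' (off_vars_setD1 AW)).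
      by rewrite -ltnS; apply: leq_ltn_trans lt; exact: max_cliques_mono.
    rewrite -ltnS; apply: leq_trans leN; rewrite ltnS.
    by rewrite -addnS leq_add //; exact: ltnW.
apply: (@reg_cliques _ _ _ _ _ _ (max_cliques A e)) => //.
- move=> i j k iA jA kA ij jk ik; apply: contraNT tr => nik.
  apply/exists_inP; exists j => //; apply/exists_inP; exists i => //.
  by apply/exists_inP; exists k; rewrite // e_sym ij jk ik nik.
- move=> i iA.
  have [B mB iB] : exists2 B, B \in max_cliques A e & [set i] \subset B.
    apply: max_clique_exists; rewrite /clique_in sub1set iA.
    by apply/cliqueP => x y; rewrite !inE => /eqP-> /eqP->; rewrite eqxx.
  by exists B; rewrite // -sub1set.
- by move=> B; rewrite inE => /maxsetP[/andP[]].
Qed.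

Lemma binomial_edge_idealE e p : simple_graph e ->
  binomial_edge_ideal e p <-> idl (@bei_gens K n setT set0 e) p.
Proof.
move=> [e_sym e_irr]; split=> [[a ->]|].
  apply: idl_sum => i _; apply: idl_sum => j /andP[_ eij].
  by apply/idlMl/bei_edge; rewrite ?inE.
elim=> [|c g q hg _ [a ->]].
  exists (fun _ _ => 0); rewrite big1 // => i _; rewrite big1 // => j _.
  by rewrite mul0r.
have add (i j : 'I_n) d :
  (i < j)%N -> e i j -> c * g = d * edge_binomial K i j ->
  binomial_edge_ideal e (c * g + \sum_(i < n)
     \sum_(j < n | (i < j)%N && e i j) a i j * edge_binomial K i j).
  move=> ij eij ->.
  exists (fun i' j' => a i' j' + (if (i' == i) && (j' == j) then d else 0)).
  under [RHS]eq_bigr do under eq_bigr do rewrite mulrDl.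
  under [RHS]eq_bigr do rewrite big_split /=.
  rewrite big_split /= addrC; congr (_ + _).
  rewrite (bigD1 i) //= [X in _ = _ + X]big1 => [|k /negbTE ki].
    rewrite addr0 (bigD1 j) ?ij //= !eqxx big1 ?addr0 //.
    move=> k /andP[_ /negbTE->].
    by rewrite andbF mul0r.
  by rewrite big1 // => l _; rewrite ki mul0r.
case: hg => [[z]|[i [j [_ _ eij gE]]]]; first by rewrite inE.
have [ij|ji|/val_inj ij] := ssrnat.ltngtP i j.
- have gE' : c * g = c * edge_binomial K i j by rewrite gE.
  exact: add ij eij gE'.
- have gE' : c * g = - c * edge_binomial K j i by rewrite gE fC mulrN mulNr.
  have eji : e j i by rewrite e_sym.
  exact: add ji eji gE'.
- by rewrite ij e_irr in eij.
Qed.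

End Main.

Theorem theorem3p5 (K : fieldType) (n : nat) (e : rel 'I_n)
    (e_simple : simple_graph e) (e_chordal : chordal e) :
  exists r : int,
    is_regularity (@binomial_edge_ideal K n e) r /\
    r <= (num_max_cliques e)%:Z.
Proof.
have E := fun p => @binomial_edge_idealE K n e p e_simple.
apply: regularity_le.
- apply: gsub_eq (gsub_bei K setT set0 e) => v.
  by split=> /E.
- move=> /E h.
  suff h0 p : idl (@bei_gens K n setT set0 e) p -> p@_0 = 0.
    by have /eqP := h0 _ h; rewrite mcoeff1 eqxx oner_eq0.
  elim=> [|a g q hg _ IH]; first by rewrite mcoeff0.
  rewrite mcoeffD IH addr0 rmorphM /=.
  case: hg => [[z]|[i [j [_ _ _ ->]]]]; first by rewrite inE.
  by rewrite fE raddfB /= !rmorphM /= !mcoeffX !mnm1_eq0 !mulr0 subrr mulr0.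
- move=> k; rewrite num_max_cliquesE.
  have sep := chordal_separated e_simple e_chordal.
  have off : off_vars [set: 'I_n] set0 by move=> i z _ _; rewrite inE.
  apply: reg_upto_eq (@reg_chordal K n _ _ _ e_simple sep off k) => // v.
  by split=> /E.
Qed.
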